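(* In the setting and under Assumptions 1-7 given in the context (in particular $n_1,n_2\to\infty$ with $n/n_1\to\kappa\in(1,\infty)$ and $n_{\ell,i}/n_\ell\to\zeta_{\ell,i}\in(0,1)$ for $i=1,\dots,k_\ell$, $\ell=1,2$), the statistic $$\hat d_1=\int_{\mathcal X}\big|m_1(x,\hat\beta_1)-m_2(x,\hat\beta_2)\big|\,dx$$ satisfies $$\sqrt n(\hat d_1-d_1)\xrightarrow{d} T:=\int_{\mathcal N^c}\operatorname{sgn}\big(m_1(x,\beta_1)-m_2(x,\beta_2)\big)\,G(x)\,dx+\int_{\mathcal N}|G(x)|\,dx,$$ where $\{G(x)\}_{x\in\mathcal X}$ is the centred Gaussian process in $\ell^\infty(\mathcal X)$ defined by $$G(x)=\Big(\tfrac{\partial}{\partial b_1}m_1(x,b_1)\big|_{b_1=\beta_1}\Big)^\top\sqrt{\kappa}\,\Sigma_1^{-1/2}Z_1-\Big(\tfrac{\partial}{\partial b_2}m_2(x,b_2)\big|_{b_2=\beta_2}\Big)^\top\sqrt{\tfrac{\kappa}{\kappa-1}}\,\Sigma_2^{-1/2}Z_2,$$ $Z_1$ and $Z_2$ are independent $p_1$- and $p_2$-dimensional standard normal random vectors, and $$\Sigma_\ell=\frac1{\sigma_\ell^2}\sum_{i=1}^{k_\ell}\zeta_{\ell,i}\Big(\tfrac{\partial}{\partial b_\ell}m_\ell(x_{\ell,i},b_\ell)\big|_{b_\ell=\beta_\ell}\Big)\Big(\tfrac{\partial}{\partial b_\ell}m_\ell(x_{\ell,i},b_\ell)\big|_{b_\ell=\beta_\ell}\Big)^\top,\qquad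 \ell=1,2.$$
   Context: Model. There are two independent samples ($\ell=1,2$) of sizes $n_1,n_2$, and $n=n_1+n_2$. In group $\ell$ there are $k_\ell$ different covariates $x_{\ell,1},\dots,x_{\ell,k_\ell}\in\mathcal X\subset\mathbb R^d$, and at $x_{\ell,i}$ one has $n_{\ell,i}$ observations, $n_\ell=\sum_{i=1}^{k_\ell}n_{\ell,i}$, given by $$Y_{\ell,i,j}=m_\ell(x_{\ell,i},\beta_\ell)+\eta_{\ell,i,j},\quad j=1,\dots,n_{\ell,i},\ i=1,\dots,k_\ell,$$ where $m_\ell(\cdot,\beta_\ell)\in\ell^\infty(\mathcal X)$ (bounded real functions on $\mathcal X$) is a regression function with parameter $\beta_\ell\in\mathbb R^{p_\ell}$, and the errors $\eta_{\ell,i,j}$ are i.i.d. within group $\ell$ with mean $0$ and variance $\sigma_\ell^2>0$. The $L^1$-distance is $d_1=d_1(\beta_1,\beta_2)=\int_{\mathcal X}|m_1(x,\beta_1)-m_2(x,\beta_2)|\,dx$, the set of coincidence points is $\mathcal N=\{x\in\mathcal X: m_1(x,\beta_1)-m_2(x,\beta_2)=0\}$, with complement $\mathcal N^c$ in $\mathcal X$. $\hat\beta_1,\hat\beta_2$ are estimators of $\beta_1,\beta_2$ from the first and second sample, respectively. $\xrightarrow{d}$ denotes convergence in distribution. Assumptions. 1. The errors $\eta_{\ell,i,j}$ have mean $0$ and finite variance $\sigma_\ell^2$. 2. $\mathcal X\subset\mathbb R^d$ is compact, and the number $k_\ell$ and location of the levels $x_{\ell,i}$ do not depend on $n_\ell$,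 $\ell=1,2$. 3. All estimators of $\beta_1,\beta_2$ are computed over compact sets $B_1\subset\mathbb R^{p_1}$, $B_2\subset\mathbb R^{p_2}$. 4. $m_1,m_2$ are twice continuously differentiable with respect to the parameters for all $b_1,b_2$ in neighbourhoods of the true parameters $\beta_1,\beta_2$ and all $x\in\mathcal X$. The functions $(x,b_\ell)\mapsto m_\ell(x,b_\ell)$ and their first two derivatives are continuous on $\mathcal X\times B_\ell$, $\ell=1,2$. 5. With $\psi^{(n)}_{a,\ell}(b)=\sum_{i=1}^{k_\ell}\frac{n_{\ell,i}}{n_\ell}(m_\ell(x_{\ell,i},a)-m_\ell(x_{\ell,i},b))^2$, for every $u>0$ there is $v_{u,\ell}>0$ with $\liminf_{n\to\infty}\inf_{a\in B_\ell}\inf_{b\in B_\ell,\,|b-a|\ge u}\psi^{(n)}_{a,\ell}(b)\ge v_{u,\ell}$, $\ell=1,2$. 6. The matrices $\Sigma_\ell$ (defined in the claim) are non-singular, and $n_1,n_2\to\infty$ such that $n_{\ell,i}/n_\ell\to\zeta_{\ell,i}>0$ for $i=1,\dots,k_\ell$, $\ell=1,2$, and $n/n_1\to\kappa\in(1,\infty)$. 7. The estimators can be linearized: $\sqrt{n_\ell}(\hat\beta_\ell-\beta_\ell)=\frac1{\sqrt{n_\ell}}\sum_{i=1}^{k_\ell}\sum_{j=1}^{n_{\ell,i}}\phi_{\ell,i,j}+o_{\mathbb P}(1)$ as $n_\ell\to\infty$, with square integrable influence functions $\phi_{\ell,i,j}$ satisfying $\mathbb E[\phi_{\ell,i,j}]=0$;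 this means that $\sqrt{n_\ell}(\hat\beta_\ell-\beta_\ell)$ converges in distribution to a centred normal law with covariance matrix $\Sigma_\ell^{-1}=\sum_{i=1}^{k_\ell}\zeta_{\ell,i}\mathbb E[\phi_{\ell,i,j}\phi_{\ell,i,j}^\top]$, $\ell=1,2$. Moreover there are variance estimators $\hat\sigma_1^2,\hat\sigma_2^2$ that are consistent for $\sigma_1^2,\sigma_2^2$.
   Formalization: Assumption 4 is read as also requiring that m_l and its first two parameter derivatives be jointly continuous on X times an open neighbourhood of beta_l; this is automatic when beta_l is interior to B_l, and without it the claim can fail for badly shaped B_l. *)

(* Defs.v *)
From HB Require Import structures.
From mathcomp Require Import all_boot all_order all_algebra.
From mathcomp Require Import all_classical all_reals all_analysis.

Set Implicit Arguments.
Unset Strict Implicit.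
Unset Printing Implicit Defensive.
Import Order.TTheory GRing.Theory Num.Theory.
Import numFieldNormedType.Exports.

Local Open Scope classical_set_scope.
Local Open Scope ring_scope.

(** Matrices carry the product sigma-algebra generated by their entries; on
    'cV[R]_n this is the Borel sigma-algebra of R^n (see open_measurable_cV). *)
Definition measure_matrix_display : measure_display -> measure_display.
Proof. exact. Qed.

Section measurable_matrix.
Context {d} {T : measurableType d}.
Variables m n : nat.

Definition matrix_cylinders : set (set 'M[T]_(m, n)) :=
  [set C | exists i j, exists2 A : set T,
     measurable A & C = [set M : 'M[T]_(m, n) | A (M i j)]].

Let mx_set0 : <<s matrix_cylinders>> set0.
Proof. exact: sigma_algebra0. Qed.

Let mx_setC A : <<s matrix_cylinders>> A -> <<s matrix_cylinders>> (~` A).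
Proof. exact: sigma_algebraC. Qed.

Let mx_bigcup (F : (set 'M[T]_(m, n))^nat) :
  (forall i, <<s matrix_cylinders>> (F i)) ->
  <<s matrix_cylinders>> (\bigcup_i (F i)).
Proof. exact: sigma_algebra_bigcup. Qed.

HB.instance Definition _ := @isMeasurable.Build (measure_matrix_display d)
  'M[T]_(m, n) <<s matrix_cylinders>> mx_set0 mx_setC mx_bigcup.

End measurable_matrix.

Lemma measurable_entry d (T : measurableType d) m n (i : 'I_m) (j : 'I_n) :
  measurable_fun [set: 'M[T]_(m, n)] (fun M : 'M[T]_(m, n) => M i j).
Proof.
move=> _ A mA; rewrite setTI; apply: sub_sigma_algebra.
by exists i, j, A.
Qed.

Lemma measurable_fun_mx d d' (S : measurableType d') (T : measurableType d) m n
    (f : S -> 'M[T]_(m, n)) :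
  (forall i j, measurable_fun [set: S] (fun s => f s i j)) ->
  measurable_fun [set: S] f.
Proof.
move=> mf; apply: (measurability (@matrix_cylinders d T m n)) => //.
move=> _ [_ [i [j [A mA ->]]] <-].
by have := mf i j measurableT A mA.
Qed.

Section power_measure.
Context {R : realType}.

Definition cons_cV n (xv : measurableTypeR R * 'cV[R]_n) : 'cV[R]_n.+1 :=
  col_mx (xv.1%:M : 'M[R]_1) xv.2.

Lemma cons_cV_head n (xv : measurableTypeR R * 'cV[R]_n) : cons_cV xv ord0 ord0 = xv.1.
Proof.
rewrite /cons_cV (_ : ord0 = lshift n (ord0 : 'I_1)); last exact: val_inj.
by rewrite (col_mxEu (xv.1%:M : 'M[R]_1) xv.2) mxE eqxx mulr1n.
Qed.

Lemma cons_cV_tail n (xv : measurableTypeR R * 'cV[R]_n) (i : 'I_n) :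
  cons_cV xv (lift ord0 i) ord0 = xv.2 i ord0.
Proof.
rewrite /cons_cV (_ : lift ord0 i = rshift 1 i); last exact: val_inj.
by rewrite (col_mxEd (xv.1%:M : 'M[R]_1) xv.2).
Qed.

Lemma measurable_cons_cV n : measurable_fun setT (@cons_cV n).
Proof.
apply: measurable_fun_mx => i j; rewrite /cons_cV.
rewrite -[n.+1]/(1 + n)%N in i *.
case: (split_ordP i) => k ->.
  under eq_fun do rewrite col_mxEu !ord1 mxE eqxx mulr1n.
  exact: measurable_fst.
under eq_fun do rewrite col_mxEd.
apply: (@measurableT_comp _ _ _ _ _ _ (fun v : 'cV[R]_n => v k j)) => //.
exact: measurable_entry.
Qed.

HB.instance Definition _ n :=
  isMeasurableFun.Build _ _ _ _ (@cons_cV n) (@measurable_cons_cV n).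

Variable mu : {sigma_finite_measure set (measurableTypeR R) -> \bar R}.

Section cons_measure.
Variables (n : nat) (nu : {sigma_finite_measure set 'cV[R]_n -> \bar R}).

Definition cons_measure : set 'cV[R]_n.+1 -> \bar R :=
  pushforward (mu \x nu)%E (@cons_cV n).

Let cons_measure0 : cons_measure set0 = 0%E.
Proof. exact: measure0. Qed.

Let cons_measure_ge0 A : (0 <= cons_measure A)%E.
Proof. exact: measure_ge0. Qed.

Let cons_measure_sigma_additive : semi_sigma_additive cons_measure.
Proof. exact: measure_semi_sigma_additive. Qed.

HB.instance Definition _ := isMeasure.Build _ _ _ cons_measure
  cons_measure0 cons_measure_ge0 cons_measure_sigma_additive.

Lemma cons_measureE (A : set R) (B : set 'cV[R]_n) :
  measurable A -> measurable B ->
  cons_measure [set v | A (v ord0 ord0) /\ B (\col_i v (lift ord0 i) ord0)] =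
  (mu A * nu B)%E.
Proof.
move=> mA mB; rewrite -(product_measure1E mu nu)//; congr ((mu \x nu)%E _).
rewrite predeqE => -[x v] /=; rewrite cons_cV_head.
by rewrite (_ : \col_i _ = v)//; apply/colP => i; rewrite mxE cons_cV_tail.
Qed.

Let cons_measure_sigma_finite : sigma_finite setT cons_measure.
Proof.
have /sigma_finiteP[F [TF ndF Foo]] := sigma_finiteT mu.
have /sigma_finiteP[G [TG ndG Goo]] := sigma_finiteT nu.
exists (fun k => [set v : 'cV[R]_n.+1 | F k (v ord0 ord0) /\
                        G k (\col_i v (lift ord0 i) ord0)]).
  rewrite predeqE => v; split => // _.
  have : [set: R] (v ord0 ord0) by [].
  have : [set: 'cV[R]_n] (\col_i v (lift ord0 i) ord0) by [].
  rewrite TF TG => -[k _ Gk] [l _ Fl]; exists (maxn k l) => //=; split.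
    by move: Fl; exact/subsetPset/ndF/leq_maxr.
  by move: Gk; exact/subsetPset/ndG/leq_maxl.
move=> k; have [mF Fk] := Foo k; have [mG Gk] := Goo k.
split; last by rewrite cons_measureE// lte_mul_pinfty// ge0_fin_numE.
apply: measurableI.
  rewrite -[X in measurable X]setTI.
  exact: (measurable_entry (T := measurableTypeR R) ord0 ord0).
have mtl : measurable_fun setT
    (fun v : 'cV[R]_n.+1 => \col_i v (lift ord0 i) ord0 : 'cV[R]_n).
  apply: measurable_fun_mx => i j; under eq_fun do rewrite mxE.
  exact: measurable_entry.
by rewrite -[X in measurable X]setTI; exact: mtl.
Qed.

HB.instance Definition _ := Measure_isSigmaFinite.Build _ _ _ cons_measure
  cons_measure_sigma_finite.

End cons_measure.

Fixpoint power_measure n : {sigma_finite_measure set 'cV[R]_n -> \bar R} :=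
  if n is n'.+1 then cons_measure (power_measure n') else \d_(0 : 'cV[R]_0).

Lemma power_measureT n : mu setT = 1%E -> power_measure n setT = 1%E.
Proof.
move=> mu1; elim: n => [|n ih]; first by rewrite /= diracT.
have := @cons_measureE _ (power_measure n) setT setT measurableT measurableT.
rewrite mu1 ih mule1 => <-; congr (cons_measure _ _).
by rewrite predeqE.
Qed.

End power_measure.

Section lebesgue_normal.
Variables (R : realType) (n : nat).

Definition lebesgue_cV : {sigma_finite_measure set 'cV[R]_n -> \bar R} :=
  power_measure (@lebesgue_measure R) n.

(** N(0, I_n) as the product of n copies of N(0, 1). *)
Definition standard_normal : set 'cV[R]_n -> \bar R :=
  power_measure (normal_prob (0 : R) 1) n.

HB.instance Definition _ := Measure.on standard_normal.

Let standard_normalT : standard_normal setT = 1%E.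
Proof. by apply: power_measureT; exact: probability_setT. Qed.

HB.instance Definition _ :=
  Measure_isProbability.Build _ _ _ standard_normal standard_normalT.

End lebesgue_normal.
Arguments lebesgue_cV {R} n.
Arguments standard_normal R n : clear implicits.

Lemma open_measurable_cV (R : realType) n (U : set 'cV[R]_n) :
  open U -> measurable U.
Proof.
move=> oU.
pose b (cq : 'cV[rat]_n * rat) := ball (map_mx ratr cq.1 : 'cV[R]_n) (ratr cq.2).
pose D := [set cq | b cq `<=` U].
have -> : U = \bigcup_(k in D) b k.
  apply/seteqP; split=> [x Ux|x [cq Dcq bx]]; last exact: Dcq.
  have [e/= e0 xeU] : nbhs_ball x U.
    by rewrite nbhs_ballE; apply: open_nbhs_nbhs.
  have [q q0 qe] : exists2 q : rat, 0 < ratr q :> R & ratr q < e / 2.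
    have /rat_in_itvoo[q] : 0 < e / 2 by rewrite divr_gt0.
    by rewrite inE /= => /itvP h; exists q; rewrite h.
  have xc' (i : 'I_n) : exists c : rat, `|x i ord0 - ratr c| < ratr q.
    have /rat_in_itvoo[c] : x i ord0 - ratr q < x i ord0 + ratr q.
      by rewrite ltrBlDr -addrA ltrDl addr_gt0.
    rewrite inE /= => /itvP h; exists c.
    by rewrite distrC ltr_distl !h.
  have [c xc] := choice xc'.
  pose c0 : 'cV[R]_n := map_mx ratr (\col_i c i).
  have xb : ball c0 (ratr q) x.
    by split => // i j; rewrite !ord1 !mxE /ball/= distrC; exact: xc.
  exists (\col_i c i, q) => //= y yb; apply: xeU.
  rewrite (splitr e); apply: (@ball_triangle _ _ c0).
    by apply: ball_sym; apply: le_ball xb; exact: ltW.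
  by apply: le_ball yb; exact: ltW.
rewrite bigcup_mkcond; apply: countable_bigcupT_measurable => [|[c q]].
  exact: countableP.
case: ifPn => // _.
have [q0|q0] := ltP 0 (ratr q : R); last first.
  rewrite (_ : b _ = set0)//; apply/seteqP; split => // x [].
  by rewrite ltNge q0.
have -> : b (c, q) = \bigcap_(i in [set: 'I_n])
    [set x : 'cV[R]_n | ball (ratr (c i ord0) : R) (ratr q) (x i ord0)].
  apply/seteqP; split=> [x [_ xb] i _ /=|x xb].
    by have := xb i ord0; rewrite mxE.
  by split => // i j; rewrite ord1 mxE; exact: xb.
apply: fin_bigcap_measurable => // i _.
rewrite -[X in measurable X]setTI; apply: measurable_entry => //.
by rewrite ball_itv; exact: measurable_itv.
Qed.

Section linear_algebra.
Context {R : realType}.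

Definition l2norm p (v : 'cV[R]_p) : R := Num.sqrt (\sum_i v i ord0 ^+ 2).

Definition psdmx p (S : 'M[R]_p) : Prop :=
  S^T = S /\ forall u : 'cV[R]_p, 0 <= (u^T *m S *m u) ord0 ord0.

(** The unique positive semidefinite square root of C, when C is itself
    positive semidefinite. *)
Definition sqrtmx p (C : 'M[R]_p) : 'M[R]_p :=
  xget 0 [set S : 'M[R]_p | psdmx S /\ S *m S = C].

End linear_algebra.

Section differentiation.
Context {R : realType}.

Definition partial p (i : 'I_p) (f : 'cV[R]_p -> R) (b : 'cV[R]_p) : R :=
  'D_(delta_mx i ord0) f b.

Definition gradient p (f : 'cV[R]_p -> R) (b : 'cV[R]_p) : 'cV[R]_p :=
  \col_i partial i f b.

(** All partial derivatives of order at most two of [m x] exist on [V] for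
    every x in [X], and they are jointly continuous on X x V. *)
Definition C2_in_parameter d p (X : set 'cV[R]_d) (V : set 'cV[R]_p)
    (m : 'cV[R]_d -> 'cV[R]_p -> R) : Prop :=
  [/\ forall x b (i : 'I_p), X x -> V b -> derivable (m x) b (delta_mx i ord0),
      forall x b (i j : 'I_p), X x -> V b ->
        derivable (partial i (m x)) b (delta_mx j ord0),
      {within X `*` V, continuous (fun z => m z.1 z.2)},
      forall i, {within X `*` V, continuous (fun z => partial i (m z.1) z.2)} &
      forall i j, {within X `*` V,
        continuous (fun z => partial j (partial i (m z.1)) z.2)}].

End differentiation.

Section probability_notions.
Context {d : measure_display} {Omega : measurableType d} {R : realType}.
Variable P : probability Omega R.

Definition mutually_independent (I : eqType) (X : I -> Omega -> R) : Prop :=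
  forall (s : seq I) (A : I -> set R), uniq s ->
    (forall i, measurable (A i)) ->
    P (\bigcap_(i in [set` s]) X i @^-1` A i) =
    (\prod_(i <- s) P (X i @^-1` A i))%E.

Definition identically_distributed (I : Type) (X : I -> Omega -> R) : Prop :=
  forall i j (A : set R), measurable A -> P (X i @^-1` A) = P (X j @^-1` A).

Definition independent2 d1 d2 (E1 : measurableType d1) (E2 : measurableType d2)
    (X : Omega -> E1) (Y : Omega -> E2) : Prop :=
  forall A B, measurable A -> measurable B ->
    P (X @^-1` A `&` Y @^-1` B) = (P (X @^-1` A) * P (Y @^-1` B))%E.

Definition standard_normal_vector p (Z : Omega -> 'cV[R]_p) : Prop :=
  measurable_fun setT Z /\
  forall A, measurable A -> P (Z @^-1` A) = standard_normal R p A.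

(** D_r = o_P(1) as r -> oo *)
Definition oP1 (D : nat -> Omega -> R) : Prop :=
  (forall r, measurable_fun setT (D r)) /\
  forall e : R, 0 < e -> P [set w | e <= `|D r w|] @[r --> \oo] --> 0%E.

End probability_notions.

(** X_r converges in distribution to Y, where Y may live on another probability
    space. Requiring every [f \o X r] to be measurable amounts, for E = R^p, to
    the Borel measurability of X_r. *)
Definition cvg_in_distribution (R : realType) (E : topologicalType)
    d (Omega : measurableType d) (P : probability Omega R)
    (X : nat -> Omega -> E)
    d' (Omega' : measurableType d') (Q : probability Omega' R)
    (Y : Omega' -> E) : Prop :=
  forall f : E -> R, continuous f -> (exists M : R, forall x, `|f x| <= M) ->
  [/\ forall r, measurable_fun setT (f \o X r),
      measurable_fun setT (f \o Y) &
      'E_P[f \o X r] @[r --> \oo] --> 'E_Q[f \o Y]]%E.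

(** N(0, C) is the law of C^(1/2) Z with Z standard normal; the random vector Z
    is realised here as the identity on (R^p, standard_normal R p). *)
Definition cvg_to_centred_normal (R : realType) d (Omega : measurableType d)
    (P : probability Omega R) p (X : nat -> Omega -> 'cV[R]_p)
    (C : 'M[R]_p) : Prop :=
  cvg_in_distribution P X (standard_normal R p) (fun z => sqrtmx C *m z).

(** One group: k covariate levels x_i, of which the i-th carries the
    observations Y_ij, j < n r i, at stage r of the asymptotics. *)
Section regression_group.
Context {R : realType} {d p k : nat}.
Context {dO : measure_display} {Omega : measurableType dO}.
Variable P : probability Omega R.
Variables (X : set 'cV[R]_d) (x : 'I_k -> 'cV[R]_d).
Variables (m : 'cV[R]_d -> 'cV[R]_p -> R) (beta : 'cV[R]_p).
Variables (B : set 'cV[R]_p) (eta : 'I_k -> nat -> Omega -> R) (sigma : R).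
Variables (n : nat -> 'I_k -> nat) (zeta : 'I_k -> R).

Definition observation (i : 'I_k) (j : nat) (w : Omega) : R :=
  m (x i) beta + eta i j w.

Definition sample_size (r : nat) : nat := \sum_(i < k) n r i.

Definition sample_sigma_algebra (r : nat) : set (set Omega) :=
  <<s [set C | exists (i : 'I_k) (j : nat), exists2 A : set R,
         (j < n r i)%N /\ measurable A & C = observation i j @^-1` A]>>.

(** A (measurable) function of the observations of the group at stage r. *)
Definition estimator dE (E : measurableType dE) (T : nat -> Omega -> E) : Prop :=
  forall r A, measurable A -> sample_sigma_algebra r (T r @^-1` A).

Definition regression_model : Prop :=
  [/\ injective x, forall i, X (x i) & [bounded m y beta | y in X]].

Definition errors_assumption : Prop :=
  [/\ 0 < sigma,
      forall i j, eta i j \in Lfun P 2%:E,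
      forall i j, ('E_P[eta i j] = 0)%E,
      forall i j, ('V_P[eta i j] = (sigma ^+ 2)%:E)%E &
      identically_distributed P (fun ij : 'I_k * nat => eta ij.1 ij.2)].

(** The second clause asks for joint continuity near beta, which follows from
    the first one when beta is interior to B but not when it is a boundary
    point. *)
Definition smoothness_assumption : Prop :=
  C2_in_parameter X B m /\
  exists U, [/\ open U, U beta & C2_in_parameter X U m].

Definition psi (r : nat) (a b : 'cV[R]_p) : R :=
  \sum_(i < k) (n r i)%:R / (sample_size r)%:R * (m (x i) a - m (x i) b) ^+ 2.

Definition identifiability_assumption : Prop :=
  let far (u : R) (a : 'cV[R]_p) := [set b | B b /\ u <= l2norm (b - a)] in
  forall u : R, 0 < u -> exists2 v : R, 0 < v &
    (v%:E <= limn_einf (fun r =>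
       ereal_inf [set ereal_inf [set (psi r a b)%:E | b in far u a]
                 | a in B]))%E.

Definition information_mx : 'M[R]_p :=
  (sigma ^+ 2)^-1 *:
    \sum_(i < k) zeta i *:
      (gradient (m (x i)) beta *m (gradient (m (x i)) beta)^T).

Definition design_assumption : Prop :=
  [/\ information_mx \in unitmx,
      (sample_size r @[r --> \oo] --> \oo)%N,
      forall i, 0 < zeta i < 1 &
      forall i, (n r i)%:R / (sample_size r)%:R @[r --> \oo] --> zeta i].

Definition second_moment_mx (phi : Omega -> 'cV[R]_p) : 'M[R]_p :=
  \matrix_(a, b) fine ('E_P[fun w => (phi w a ord0 * phi w b ord0)%R])%E.

Definition scaled_error (betahat : nat -> Omega -> 'cV[R]_p) r w : 'cV[R]_p :=
  Num.sqrt (sample_size r)%:R *: (betahat r w - beta).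

(** The last two clauses are the asymptotic normality that the linearization
    stands for. *)
Definition linearization_assumption (betahat : nat -> Omega -> 'cV[R]_p)
    (phi : 'I_k -> nat -> Omega -> 'cV[R]_p) : Prop :=
  [/\ forall i j a, (fun w => phi i j w a ord0) \in Lfun P 2%:E,
      forall i j a, ('E_P[fun w => phi i j w a ord0] = 0)%E,
      oP1 P (fun r w => l2norm (scaled_error betahat r w -
        (Num.sqrt (sample_size r)%:R)^-1 *:
          \sum_(i < k) \sum_(j < n r i) phi i j w)),
      forall j, invmx information_mx =
        \sum_(i < k) zeta i *: second_moment_mx (phi i j) &
      cvg_to_centred_normal P (scaled_error betahat) (invmx information_mx)].

Definition consistent_variance_estimator (s2 : nat -> Omega -> R) : Prop :=
  estimator s2 /\ oP1 P (fun r w => s2 r w - sigma ^+ 2).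

End regression_group.

(** The errors of the two groups as a single family. *)
Definition pooled (k1 k2 : nat) (Omega R : Type)
    (eta1 : 'I_k1 -> nat -> Omega -> R) (eta2 : 'I_k2 -> nat -> Omega -> R)
    (u : 'I_k1 * nat + 'I_k2 * nat) : Omega -> R :=
  match u with inl ij => eta1 ij.1 ij.2 | inr ij => eta2 ij.1 ij.2 end.

Section L1_distance.
Context {R : realType} {d p1 p2 : nat}.
Variables (X : set 'cV[R]_d).
Variables (m1 : 'cV[R]_d -> 'cV[R]_p1 -> R) (m2 : 'cV[R]_d -> 'cV[R]_p2 -> R).

Definition L1_distance (b1 : 'cV[R]_p1) (b2 : 'cV[R]_p2) : R :=
  \int[lebesgue_cV d]_(x in X) `|m1 x b1 - m2 x b2|.

Definition coincidence_set (b1 : 'cV[R]_p1) (b2 : 'cV[R]_p2) : set 'cV[R]_d :=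
  [set x | X x /\ m1 x b1 - m2 x b2 = 0].

(** A path of the Gaussian process G, given realisations [z1], [z2] of the
    standard normal vectors; S^(-1/2) is taken as (S^-1)^(1/2). *)
Definition limit_process (S1 : 'M[R]_p1) (S2 : 'M[R]_p2) (kappa : R)
    (b1 : 'cV[R]_p1) (b2 : 'cV[R]_p2) (z1 : 'cV[R]_p1) (z2 : 'cV[R]_p2)
    (x : 'cV[R]_d) : R :=
  ((gradient (m1 x) b1)^T *m
     (Num.sqrt kappa *: (sqrtmx (invmx S1) *m z1))) ord0 ord0 -
  ((gradient (m2 x) b2)^T *m
     (Num.sqrt (kappa / (kappa - 1)) *: (sqrtmx (invmx S2) *m z2))) ord0 ord0.

Definition limit_functional (b1 : 'cV[R]_p1) (b2 : 'cV[R]_p2)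
    (G : 'cV[R]_d -> R) : R :=
  \int[lebesgue_cV d]_(x in X `\` coincidence_set b1 b2)
     (Num.sg (m1 x b1 - m2 x b2) * G x) +
  \int[lebesgue_cV d]_(x in coincidence_set b1 b2) `|G x|.

End L1_distance.

(* Main.v *)
From HB Require Import structures.
Require Import Defs.
From mathcomp Require Import all_boot all_order all_algebra.
From mathcomp Require Import all_classical all_reals all_analysis.
From mathcomp Require Import measurable_realfun ring lra.
Import Order.TTheory GRing.Theory Num.Theory.
Import numFieldNormedType.Exports.
Local Open Scope classical_set_scope.
Local Open Scope ring_scope.

(** The limit comes from an extended continuous-mapping argument, in which all
    the analysis is deterministic.

    The statistic is a function of the pair of scaled estimation errors
    U_r = (sqrt n1 (betahat1 - beta1), sqrt n2 (betahat2 - beta2)).  The two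
    components converge in law to S1 Z1 and S2 Z2, and they are independent
    because the estimators are functions of disjoint families of independent
    errors ([estimators_independent]).  Joint convergence U_r -> V follows
    ([independent_joint_cvg]).

    The function carrying U_r to the statistic depends on r, so it is enough to
    know how it behaves locally: if U_r is close to a fixed u and r is large,
    then sqrt n (dhat - d) is close to F(u), where F(u) is the limit functional
    evaluated at the path x |-> g_u(x) that is linear in u
    ([L1_distance_delta]).  Compactness of X makes the Taylor expansion of
    m_l(x, .) at beta_l uniform in x ([uniform_taylor]), so that
    sqrt n (D_b - D) is uniformly close to g_u, where D and D_b are the
    differences of the two regression functions at the true parameter and at
    the perturbed one.  The remaining quantity
    int_X sqrt n (|D + g_u / sqrt n| - |D|) tends to F(u) by dominated
    convergence: the integrand is bounded by |g_u| and its pointwise limit is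
    the directional derivative of the absolute value, sgn(D) g_u off the
    coincidence set and |g_u| on it.

    Passing from this local statement to expectations ([asymptotic_mapping])
    would usually go through tightness or an almost sure representation.  Here
    the image sequence is instead bounded below by Lipschitz functions of U_r,
    to which convergence in law applies directly; the same device proves the
    joint convergence. *)

Set Implicit Arguments.
Unset Strict Implicit.

(** * Bounded functions on a probability space *)

Section bounded_expectations.
Context d (T : measurableType d) (R : realType) (P : probability T R).
Implicit Types (f g : T -> R) (M e : R).

Lemma probability_inhabited : exists w : T, True.
Proof.
apply: contrapT => T0; have := @probability_setT _ _ _ P.
rewrite (_ : [set: T] = set0) ?measure0 => [/eqP|]; first by rewrite eqe eq_sym oner_eq0.
by rewrite -subset0 => w _; apply: T0; exists w.
Qed.

Lemma bounded_integrable f M : measurable_fun setT f ->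
  (forall w, `|f w| <= M) -> P.-integrable setT (EFin \o f).
Proof.
move=> mf fM; apply: measurable_bounded_integrable => //.
  by rewrite [X in (X < _)%E](probability_setT P) ltry.
exists M; split; first exact: num_real.
by move=> x Mx w _ /=; exact: le_trans (fM w) (ltW Mx).
Qed.

Lemma expectation_bounded f M : measurable_fun setT f ->
  (forall w, `|f w| <= M) -> 'E_P[f]%E = (\int[P]_w f w)%:E.
Proof.
move=> mf fM; rewrite unlock /Rintegral fineK//.
by apply: integrable_fin_num => //; exact: bounded_integrable fM.
Qed.

Lemma Rintegral_probability_cst (c : R) : \int[P]_w c = c.
Proof.
rewrite Rintegral_cst// (_ : fine _ = 1) ?mulr1// -[1]/(fine 1%E).
by congr fine; exact: probability_setT.
Qed.

Lemma le_Rintegral_bounded f g M : measurable_fun setT f ->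
  measurable_fun setT g -> (forall w, `|f w| <= M) -> (forall w, `|g w| <= M) ->
  (forall w, f w <= g w) -> \int[P]_w f w <= \int[P]_w g w.
Proof.
move=> mf mg fM gM fg; apply: le_Rintegral => //; exact: bounded_integrable.
Qed.

Lemma Rintegral_dist_le f g M e : measurable_fun setT f ->
  measurable_fun setT g -> (forall w, `|f w| <= M) -> (forall w, `|g w| <= M) ->
  (forall w, `|f w - g w| <= e) -> `|\int[P]_w f w - \int[P]_w g w| <= e.
Proof.
move=> mf mg fM gM fge.
have If := bounded_integrable mf fM; have Ig := bounded_integrable mg gM.
rewrite -RintegralB//.
have mfg : measurable_fun setT (fun w => f w - g w) by exact: measurable_funB.
have Ifg := bounded_integrable mfg fge.
apply: (le_trans (le_normr_Rintegral measurableT Ifg)).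
rewrite -[leRHS]Rintegral_probability_cst; apply: le_Rintegral => //.
- apply: (@bounded_integrable (fun w => `|f w - g w|) e); first exact: measurableT_comp.
  by move=> w; rewrite normr_id.
- by apply: (@bounded_integrable (fun=> e) `|e|).
Qed.

Lemma Rintegral_norm_le f M : measurable_fun setT f ->
  (forall w, `|f w| <= M) -> `|\int[P]_w f w| <= M.
Proof.
move=> mf fM; rewrite -[X in `|X|]subr0 -[X in _ - X](Rintegral_probability_cst 0).
apply: (Rintegral_dist_le (M := M)) => //.
- by move=> w; rewrite normr0; apply: le_trans (fM w).
- by move=> w; rewrite subr0.
Qed.

Lemma Rintegral_bounded_cvg (f_ : nat -> T -> R) f M :
  (forall k, measurable_fun setT (f_ k)) ->
  (forall k w, `|f_ k w| <= M) -> (forall w, f_ k w @[k --> \oo] --> f w) ->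
  \int[P]_w f_ k w @[k --> \oo] --> \int[P]_w f w.
Proof.
move=> mf fM ff; apply: fine_cvg; rewrite /Rintegral fineK; last first.
  apply: integrable_fin_num => //; apply: (@bounded_integrable _ M).
    by apply: measurable_fun_cvg => // w _; exact: ff.
  move=> w; have /cvgr_to_le : `|f_ k w| @[k --> \oo] --> `|f w|.
    by apply: cvg_norm; exact: ff.
  by apply; near=> k; exact: fM.
apply: (@dominated_cvg _ _ _ _ _ _ _ _ (fun=> M%:E)) => //.
- by move=> n; apply/measurable_EFinP.
- by move=> w _; apply: cvg_EFin; [near=> k | exact: ff].
- exact: finite_measure_integrable_cst.
- by move=> k w _; rewrite lee_fin.
Unshelve. all: by end_near.
Qed.

End bounded_expectations.

(** * Asymptotic mapping by Lipschitz envelopes *)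

Section asymptotic_mapping.
Context (R : realType) (E : normedModType R).
Context d (Omega : measurableType d) (P : probability Omega R).
Context d' (Omega' : measurableType d') (Q : probability Omega' R).

(** Convergence in law tested on bounded Lipschitz functions only.  Lipschitz
    tests are what makes the joint law of independent sequences tractable:
    averaging a Lipschitz function over one argument leaves a Lipschitz
    function of the other, with the same constant. *)
Definition cvg_bounded_lipschitz (U : nat -> Omega -> E) (V : Omega' -> E) :=
  forall (g : E -> R) (M K : R), (forall u, `|g u| <= M) ->
    (forall u v, `|g u - g v| <= K * `|u - v|) ->
  [/\ forall r, measurable_fun setT (g \o U r), measurable_fun setT (g \o V) &
      \int[P]_w g (U r w) @[r --> \oo] --> \int[Q]_w g (V w)].

Section lower_envelope.
Variables (U : nat -> Omega -> E) (T : nat -> Omega -> R) (M : R).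
Hypothesis T_ge0 : forall r w, 0 <= T r w.
Hypothesis T_leM : forall r w, T r w <= M.

(** The largest k-Lipschitz function bounded by M whose value at U_r(w) is at
    most T_r(w) for every r >= k: an inf-convolution of the graph formed by all
    the points (U_r(w), T_r(w)) with r >= k. *)
Definition envelope_set (k : nat) (u : E) : set R :=
  [set t | exists r w, (k <= r)%N /\ t = Num.min M (T r w + k%:R * `|U r w - u|)].

Definition envelope k u := inf (envelope_set k u).

Let M_ge0 : 0 <= M.
Proof. by have [w _] := probability_inhabited P; apply: le_trans (T_leM 0 w). Qed.

Let envelope_nonempty k u : envelope_set k u !=set0.
Proof.
have [w _] := probability_inhabited P.
by exists (Num.min M (T k w + k%:R * `|U k w - u|)); exists k, w.
Qed.

Let envelope_set_ge0 k u : lbound (envelope_set k u) 0.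
Proof. by move=> _ [r [w [_ ->]]]; rewrite le_min M_ge0 addr_ge0// mulr_ge0. Qed.

Lemma envelope_le k u r w : (k <= r)%N ->
  envelope k u <= Num.min M (T r w + k%:R * `|U r w - u|).
Proof.
move=> kr; apply: ge_inf; last by exists r, w.
by exists 0; exact: envelope_set_ge0.
Qed.

Lemma envelope_ge k u t :
  (forall r w, (k <= r)%N -> t <= Num.min M (T r w + k%:R * `|U r w - u|)) ->
  t <= envelope k u.
Proof.
move=> h; apply: lb_le_inf; first exact: envelope_nonempty.
by move=> _ [r [w [kr ->]]]; exact: h.
Qed.

Lemma envelope_ge0 k u : 0 <= envelope k u.
Proof. by apply: envelope_ge => r w _; rewrite le_min M_ge0 addr_ge0// mulr_ge0. Qed.

Lemma envelope_leM k u : envelope k u <= M.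
Proof.
have [w _] := probability_inhabited P.
by apply: le_trans (envelope_le u w (leqnn k)) _; rewrite ge_min lexx.
Qed.

Lemma envelope_norm k u : `|envelope k u| <= M.
Proof. by rewrite ger0_norm ?envelope_ge0 ?envelope_leM. Qed.

Lemma envelope_at k r w : (k <= r)%N -> envelope k (U r w) <= T r w.
Proof.
move=> kr; apply: le_trans (envelope_le _ w kr) _.
by rewrite subrr normr0 mulr0 addr0 ge_min lexx orbT.
Qed.

(** Each function over which the infimum is taken is k-Lipschitz in u, by the
    triangle inequality. *)
Let envelope_lip1 k u v : envelope k u - k%:R * `|u - v| <= envelope k v.
Proof.
apply: envelope_ge => r w kr; rewrite lerBlDr.
apply: le_trans (envelope_le _ w kr) _; rewrite ge_min.
have k0 : 0 <= k%:R * `|u - v| by rewrite mulr_ge0.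
have Muv : M <= M + k%:R * `|u - v| by rewrite lerDl.
have : k%:R * `|U r w - u| <= k%:R * `|U r w - v| + k%:R * `|u - v|.
  rewrite -mulrDr ler_wpM2l//.
  by rewrite (distrC u v) ler_distD.
case: (leP M (T r w + k%:R * `|U r w - v|)) => [h|h].
  by rewrite Muv.
move=> h2; apply/orP; right.
by rewrite -addrA lerD2l.
Qed.

Lemma envelope_lipschitz k u v :
  `|envelope k u - envelope k v| <= k%:R * `|u - v|.
Proof.
have h1 := envelope_lip1 k u v; have := envelope_lip1 k v u.
by rewrite (distrC v u) ler_norml => h2; apply/andP; split; lra.
Qed.

End lower_envelope.

(** If T_r eventually stays above F(u) - e near u, the envelopes h_k satisfy
    liminf_k h_k >= F pointwise: points U_r(w) close to u contribute at least
    F(u) - e, and points at distance dl or more contribute at least k dl, which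
    exceeds M for large k.  So E F(V) is nearly bounded by E h_k(V) for some
    fixed k; the latter is the limit of E h_k(U_r), and E h_k(U_r) <= E T_r. *)
Lemma asymptotic_lower_bound (U : nat -> Omega -> E) (V : Omega' -> E)
    (T : nat -> Omega -> R) (F : E -> R) (M : R) :
  cvg_bounded_lipschitz U V ->
  (forall r, measurable_fun setT (T r)) -> measurable_fun setT (F \o V) ->
  (forall r w, 0 <= T r w) -> (forall r w, T r w <= M) ->
  (forall u, `|F u| <= M) ->
  (forall u (e : R), 0 < e -> exists2 dl : R, 0 < dl &
     exists K, forall r w, (K <= r)%N -> `|U r w - u| < dl -> F u - e <= T r w) ->
  forall e : R, 0 < e ->
    \forall r \near \oo, \int[Q]_w F (V w) - e <= \int[P]_w T r w.
Proof.
move=> UV mT mF T0 TM FM near_F e e0.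
pose h := envelope U T M.
have hM k u : `|h k u| <= M by exact: envelope_norm.
have h_lip k u v : `|h k u - h k v| <= k%:R * `|u - v| by exact: envelope_lipschitz.
have h_cvg k := UV (h k) M k%:R (hM k) (h_lip k).
(* capping by F turns the one-sided bound into a pointwise limit, as
   dominated convergence requires *)
pose hF k u := Num.min (h k u) (F u).
have hF_M k u : `|hF k u| <= M.
  by rewrite /hF; case: (leP (h k u) (F u)) => _; [exact: hM | exact: FM].
have mhF k : measurable_fun setT (hF k \o V).
  by apply: measurable_minr => //; have [_ + _] := h_cvg k.
have hF_cvg u : hF k u @[k --> \oo] --> F u.
  apply/cvgrPdist_le => a a0; have [dl dl0 [K HK]] := near_F u a a0.
  have [k0 k0M] : exists k0 : nat, M <= k0%:R * dl.
    exists (Num.truncn (M / dl)).+1; rewrite -ler_pdivrMr//.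
    by rewrite ltW// Num.Theory.truncnS_gt.
  near=> k.
  have h_ge : F u - a <= h k u.
    apply: envelope_ge => r w kr; rewrite le_min; apply/andP; split.
      by rewrite lerBlDr; apply: le_trans (ler_norm _) (le_trans (FM u) _); rewrite lerDl ltW.
    case: (ltP `|U r w - u| dl) => [near_u|far_u].
      apply: le_trans (HK r w _ near_u) _; last by rewrite lerDl mulr_ge0.
      by apply: leq_trans kr; near: k; exact: nbhs_infty_ge.
    apply: (@le_trans _ _ M).
      by rewrite lerBlDr; apply: le_trans (ler_norm _) (le_trans (FM u) _); rewrite lerDl ltW.
    apply: (le_trans k0M); rewrite -[leLHS]add0r lerD//.
    apply: ler_pM => //; first exact: ltW.
    by rewrite ler_nat; near: k; exact: nbhs_infty_ge.
  rewrite /hF; case: (leP (h k u) (F u)) => [h1|h1].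
    by rewrite ger0_norm ?subr_ge0// lerBlDr addrC -lerBlDr.
  by rewrite subrr normr0 ltW.
have e2 : 0 < e / 2 by rewrite divr_gt0.
have /cvgrPdist_le/(_ _ e2)[k0 _ hk0] := @Rintegral_bounded_cvg _ _ _ Q _ _ M mhF
  (fun k w => hF_M k (V w)) (fun w => hF_cvg (V w)).
have [mhU mhV /cvgrPdist_le/(_ _ e2) hU] := h_cvg k0.
near=> r.
have a1 : \int[P]_w h k0 (U r w) <= \int[P]_w T r w.
  apply: (@le_Rintegral_bounded _ _ _ P (fun w => h k0 (U r w)) (T r) M) => //.
  - exact: mhU.
  - by move=> w; rewrite ger0_norm.
  - by move=> w; apply: envelope_at => //; near: r; exact: nbhs_infty_ge.
have a2 : \int[Q]_w hF k0 (V w) <= \int[Q]_w h k0 (V w).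
  apply: (@le_Rintegral_bounded _ _ _ Q (fun w => hF k0 (V w)) (fun w => h k0 (V w)) M).
  - exact: mhF.
  - exact: mhV.
  - by move=> w; exact: hF_M.
  - by move=> w; exact: hM.
  - by move=> w; rewrite /hF/= ge_min lexx.
have a3 : `|\int[Q]_w h k0 (V w) - \int[P]_w h k0 (U r w)| <= e / 2 by near: r.
have a4 := hk0 k0 (leqnn k0); move: a3 a4 => /=.
by rewrite !ler_norml => /andP[_ a3] /andP[_ a4]; lra.
Unshelve. all: by end_near.
Qed.

(** An extended continuous-mapping principle: T_r need not be a function of U_r,
    it only has to be close to F(u) on the event that U_r is close to u. The
    lower bound is applied to M + T_r and to M - T_r. *)
Lemma asymptotic_mapping (U : nat -> Omega -> E) (V : Omega' -> E)
    (T : nat -> Omega -> R) (F : E -> R) (M : R) :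
  cvg_bounded_lipschitz U V ->
  (forall r, measurable_fun setT (T r)) -> measurable_fun setT (F \o V) ->
  (forall r w, `|T r w| <= M) -> (forall u, `|F u| <= M) ->
  (forall u (e : R), 0 < e -> exists2 dl : R, 0 < dl &
     exists K, forall r w, (K <= r)%N -> `|U r w - u| < dl ->
       `|T r w - F u| <= e) ->
  \int[P]_w T r w @[r --> \oo] --> \int[Q]_w F (V w).
Proof.
move=> UV mT mF TM FM near_F; apply/cvgrPdist_le => e e0.
have shift (s : R) (Os : s = 1 \/ s = -1) : \forall r \near \oo,
    \int[Q]_w (M + s * F (V w)) - e <= \int[P]_w (M + s * T r w).
  have sM (y : R) : `|y| <= M -> `|s * y| <= M.
    by rewrite normrM; case: Os => ->; rewrite ?normrN normr1 mul1r.
  apply: (@asymptotic_lower_bound U V (fun r w => M + s * T r w)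
    (fun u => M + s * F u) (M + M)) => //.
  - by move=> r; apply: measurable_funD => //; exact: measurable_funM.
  - by apply: measurable_funD => //; exact: measurable_funM.
  - by move=> r w; have := sM _ (TM r w); rewrite ler_norml => /andP[]; lra.
  - by move=> r w; have := sM _ (TM r w); rewrite ler_norml => /andP[]; lra.
  - move=> u; apply: le_trans (ler_normD _ _) _; rewrite lerD ?sM//.
    by rewrite ger0_norm// (le_trans _ (FM u)).
  - move=> u a a0; have [dl dl0 [K HK]] := near_F u a a0; exists dl => //.
    exists K => r w Kr /(HK _ _ Kr); rewrite ler_norml => /andP[h1 h2].
    by case: Os => ->; lra.
have expand d0 (O : measurableType d0) (PP : probability O R) (s : R) (f : O -> R) :
    measurable_fun setT f -> (forall w, `|f w| <= M) ->
    \int[PP]_w (M + s * f w) = M + s * \int[PP]_w f w.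
  move=> mf fM; have If := bounded_integrable PP mf fM.
  rewrite RintegralD ?Rintegral_probability_cst ?RintegralZl//.
    exact: finite_measure_integrable_cst.
  apply: (@bounded_integrable _ _ _ PP (fun w => s * f w) (`|s| * M)).
    exact: measurable_funM.
  by move=> w; rewrite normrM ler_wpM2l.
have s1 := shift 1 (or_introl erefl); have s2 := shift (-1) (or_intror erefl).
near=> r.
have r1 : \int[Q]_w (M + 1 * F (V w)) - e <= \int[P]_w (M + 1 * T r w) by near: r.
have r2 : \int[Q]_w (M + -1 * F (V w)) - e <= \int[P]_w (M + -1 * T r w) by near: r.
move: r1 r2; rewrite !(expand _ _ _ _ (T r))// !(expand _ _ Q _ (F \o V))//.
by rewrite ler_norml => h1 h2; apply/andP; split; lra.
all: by move=> w; exact: FM.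
Unshelve. all: by end_near.
Qed.

End asymptotic_mapping.

(** * The sup norm, measurability and change of variables *)

Section matrix_sup_norm.
Context {R : realType}.

Lemma mx_entry_le_norm m n (A : 'M[R]_(m, n)) i j : `|A i j| <= `|A|.
Proof.
have -> : `|A| = mx_norm A by [].
by rewrite mx_normrE; apply: (le_bigmax _ (fun ij => `|A ij.1 ij.2|) (i, j)).
Qed.

Lemma mx_norm_le_entries m n (A : 'M[R]_(m, n)) (c : R) : 0 <= c ->
  (forall i j, `|A i j| <= c) -> `|A| <= c.
Proof.
move=> c0 Ac; have -> : `|A| = mx_norm A by [].
by rewrite mx_normrE; apply/bigmax_leP; split => // -[i j] _; exact: Ac.
Qed.

Lemma norm_col_mx_le m1 m2 n (A : 'M[R]_(m1, n)) (B : 'M[R]_(m2, n)) (c : R) :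
  `|A| <= c -> `|B| <= c -> `|col_mx A B| <= c.
Proof.
move=> Ac Bc; apply: mx_norm_le_entries => [|i j]; first exact: le_trans Ac.
case: (split_ordP i) => k ->; rewrite ?col_mxEu ?col_mxEd.
  exact: le_trans (mx_entry_le_norm A k j) Ac.
exact: le_trans (mx_entry_le_norm B k j) Bc.
Qed.

Lemma norm_usubmx_le m1 m2 n (A : 'M[R]_(m1 + m2, n)) : `|usubmx A| <= `|A|.
Proof. by apply: mx_norm_le_entries => // i j; rewrite mxE mx_entry_le_norm. Qed.

Lemma norm_dsubmx_le m1 m2 n (A : 'M[R]_(m1 + m2, n)) : `|dsubmx A| <= `|A|.
Proof. by apply: mx_norm_le_entries => // i j; rewrite mxE mx_entry_le_norm. Qed.

End matrix_sup_norm.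

Section lipschitz_measurable.
Context {R : realType}.

Lemma lipschitz_is_continuous (E F : normedModType R) (g : E -> F) (K : R) :
  (forall u v, `|g u - g v| <= K * `|u - v|) -> continuous g.
Proof.
move=> gK u; apply/cvgrPdist_le => e e0; near=> v.
apply: le_trans (gK u v) _; apply: (@le_trans _ _ ((`|K| + 1) * `|u - v|)).
  by rewrite ler_wpM2r// (le_trans (ler_norm K))// lerDl.
rewrite mulrC -ler_pdivlMr ?ltr_wpDl//.
near: v; apply: cvgr_dist_le; first exact: cvg_id.
by rewrite divr_gt0// ltr_wpDl.
Unshelve. all: by end_near.
Qed.

Lemma continuous_measurable_cV p (g : 'cV[R]_p -> R) :
  continuous g -> measurable_fun setT g.
Proof.
move=> /continuousP cg; apply: (measurability _ (measurable_realfun.RGenOpens.measurableE R)).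
move=> _ [_ [a [b ->] <-]]; rewrite setTI; apply: open_measurable_cV.
by apply: cg; exact: interval_open.
Qed.

(** Partial averages of a Lipschitz function inherit its Lipschitz constant; this
    is how they are seen to be measurable. *)
Lemma lipschitz_measurable_cV p (g : 'cV[R]_p -> R) (K : R) :
  (forall u v, `|g u - g v| <= K * `|u - v|) -> measurable_fun setT g.
Proof. by move/lipschitz_is_continuous/continuous_measurable_cV. Qed.

Lemma measurable_col_mx d (T : measurableType d) p q (f : T -> 'cV[R]_p)
    (g : T -> 'cV[R]_q) : measurable_fun setT f -> measurable_fun setT g ->
  measurable_fun setT (fun t => col_mx (f t) (g t)).
Proof.
move=> mf mg; apply: measurable_fun_mx => i j.
case: (split_ordP i) => k ->.
  under eq_fun do rewrite col_mxEu.
  by apply: (@measurableT_comp _ _ _ _ _ _ (fun v : 'cV[R]_p => v k j)) => //;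
    exact: measurable_entry.
under eq_fun do rewrite col_mxEd.
by apply: (@measurableT_comp _ _ _ _ _ _ (fun v : 'cV[R]_q => v k j)) => //;
  exact: measurable_entry.
Qed.

End lipschitz_measurable.

Section change_of_variables.
Context {R : realType} d (Omega : measurableType d) (P : probability Omega R).

Lemma Rintegral_same_law d1 (E : measurableType d1) (X : Omega -> E)
    (nu : probability E R) (g : E -> R) (M : R) :
  measurable_fun setT X -> (forall A, measurable A -> P (X @^-1` A) = nu A) ->
  measurable_fun setT g -> (forall x, `|g x| <= M) ->
  \int[P]_w g (X w) = \int[nu]_x g x.
Proof.
move=> mX Xnu mg gM; rewrite /Rintegral; congr fine.
pose X' : {mfun Omega >-> E} := HB.pack X (isMeasurableFun.Build _ _ _ _ X mX).
transitivity (\int[distribution P X']_x (g x)%:E)%E.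
  rewrite integral_distribution//; first exact/measurable_EFinP.
  apply: (@bounded_integrable _ _ _ _ (g \o X) M) => [|w].
    exact: measurableT_comp.
  exact: gM.
by apply: eq_measure_integral => A mA _; exact: Xnu.
Qed.

(** Independence says that the joint law of (X, Y) agrees with the product of the
    marginal laws on rectangles, hence everywhere; then Fubini applies. *)
Lemma independent2_Rintegral d1 d2 (E1 : measurableType d1)
    (E2 : measurableType d2) (X : Omega -> E1) (Y : Omega -> E2)
    (f : E1 * E2 -> R) (M : R) :
  measurable_fun setT X -> measurable_fun setT Y -> independent2 P X Y ->
  measurable_fun setT f -> (forall z, `|f z| <= M) ->
  \int[P]_w f (X w, Y w) = \int[P]_w (\int[P]_w' f (X w', Y w)).
Proof.
move=> mX mY indep mf fM.
pose X' : {mfun Omega >-> E1} := HB.pack X (isMeasurableFun.Build _ _ _ _ X mX).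
pose Y' : {mfun Omega >-> E2} := HB.pack Y (isMeasurableFun.Build _ _ _ _ Y mY).
have mXY : measurable_fun setT (fun w => (X w, Y w)).
  by apply/measurable_fun_pairP.
pose XY : {mfun Omega >-> (E1 * E2)%type} :=
  HB.pack (fun w => (X w, Y w)) (isMeasurableFun.Build _ _ _ _ (fun w => (X w, Y w)) mXY).
pose mu1 := distribution P X'; pose mu2 := distribution P Y'.
have intf : (mu1 \x mu2)%E.-integrable setT (EFin \o f).
  apply: measurable_bounded_integrable => //.
    have := @product_measure1E _ _ _ _ _ mu1 mu2 setT setT measurableT measurableT.
    rewrite setXTT [X in (X * _)%E](probability_setT mu1).
    by rewrite [X in (_ * X)%E](probability_setT mu2) mule1 => h; rewrite [X in (X < _)%E]h ltry.
  exists M; split; first exact: num_real.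
  by move=> x Mx w _ /=; exact: le_trans (fM w) (ltW Mx).
rewrite /Rintegral; congr fine.
transitivity (\int[distribution P XY]_z (f z)%:E)%E.
  rewrite integral_distribution//; first exact/measurable_EFinP.
  by apply: (@bounded_integrable _ _ _ _ (f \o XY) M) => [|w]; [exact: measurableT_comp|exact: fM].
transitivity (\int[mu1 \x mu2]_z (f z)%:E)%E.
  apply: eq_measure_integral => A mA _.
  rewrite -(@product_measure_unique _ _ _ _ _ mu1 mu2 (distribution P XY))//.
transitivity (\int[mu2]_y fubini_G mu1 (EFin \o f) y)%E.
  by rewrite integral21_prod_meas1.
have mf1 w : measurable_fun setT (fun w' => f (X w', Y w)).
  by apply: measurableT_comp => //; exact: measurable_fun_pair.
pose G w := \int[P]_w' f (X w', Y w).
have fE w : fubini_G mu1 (EFin \o f) (Y w) = (G w)%:E.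
  rewrite /fubini_G integral_distribution//.
  - rewrite /G /Rintegral fineK//; apply: integrable_fin_num => //.
    exact: (bounded_integrable P (mf1 w) (fun w' => fM _)).
  - by apply/measurable_EFinP; exact: measurable_fun_pair1.
  - exact: (bounded_integrable P (mf1 w) (fun w' => fM _)).
have fEG : fubini_G mu1 (EFin \o f) \o Y' = EFin \o G by apply/funext => w; exact: fE.
rewrite integral_distribution/=; first by apply: eq_integral => w _; exact: fE.
  exact: measurable_fubini_G intf.
rewrite fEG; apply: (@bounded_integrable _ _ _ P G M).
  apply/measurable_EFinP; rewrite -fEG.
  by apply: measurableT_comp => //; exact: measurable_fubini_G intf.
by move=> w; apply: Rintegral_norm_le.
Qed.

End change_of_variables.

(** * Joint convergence of independent sequences *)

Section joint_convergence.
Context {R : realType}.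
Context d (Omega : measurableType d) (P : probability Omega R).
Context d' (Omega' : measurableType d') (Q : probability Omega' R).

Lemma measurable_mulmx p q (C : 'M[R]_(p, q)) (f : Omega -> 'cV[R]_q) :
  measurable_fun setT f -> measurable_fun setT (fun w => C *m f w).
Proof.
move=> mf; apply: measurable_fun_mx => i j; under eq_fun do rewrite mxE.
apply: measurable_sum => k; apply: measurable_funM => //.
by apply: (@measurableT_comp _ _ _ _ _ _ (fun v : 'cV[R]_q => v k j)) => //;
  exact: measurable_entry.
Qed.

Lemma independent2_comp d1 d2 d3 d4 (E1 : measurableType d1)
    (E2 : measurableType d2) (F1 : measurableType d3) (F2 : measurableType d4)
    (X : Omega -> E1) (Y : Omega -> E2) (a : E1 -> F1) (b : E2 -> F2) :
  measurable_fun setT a -> measurable_fun setT b ->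
  independent2 P X Y -> independent2 P (a \o X) (b \o Y).
Proof.
move=> ma mb indep A B mA mB; apply: (indep (a @^-1` A) (b @^-1` B)).
  by rewrite -[X in measurable X]setTI; exact: ma.
by rewrite -[X in measurable X]setTI; exact: mb.
Qed.

(** The limit law, realised on (R^p, N(0, I)) by the hypothesis, is moved to the
    space that carries Z. *)
Lemma cvg_bounded_lipschitz_normal p (X : nat -> Omega -> 'cV[R]_p)
    (C : 'M[R]_p) (Z : Omega' -> 'cV[R]_p) :
  cvg_to_centred_normal P X C -> standard_normal_vector Q Z ->
  cvg_bounded_lipschitz P Q X (fun w => sqrtmx C *m Z w).
Proof.
move=> XC [mZ Zlaw] g M K gM gK.
have [mX mC gXC] := XC g (lipschitz_is_continuous gK) (ex_intro _ M gM).
have gCE : \int[Q]_w g (sqrtmx C *m Z w) =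
    \int[standard_normal R p]_z g (sqrtmx C *m z).
  exact: (Rintegral_same_law mZ Zlaw mC (fun z => gM _)).
split => //; first exact: (measurableT_comp mC mZ).
rewrite gCE; apply: fine_cvg; move: gXC; rewrite (expectation_bounded _ mC (fun z => gM _)).
by under eq_fun do rewrite unlock.
Qed.

(** By Fubini E f(X_r, Y_r) = E g_r(Y_r) with g_r(y) = E f(X_r, y).  For each y,
    g_r(y) tends to E f(X', y), and the g_r share a Lipschitz constant, so that
    g_r(Y_r) is close to that limit whenever Y_r is close to y and r is large:
    the asymptotic mapping principle applies to Y_r. *)
Lemma independent_joint_cvg p q (X : nat -> Omega -> 'cV[R]_p)
    (Y : nat -> Omega -> 'cV[R]_q) (X' : Omega' -> 'cV[R]_p)
    (Y' : Omega' -> 'cV[R]_q) :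
  (forall r, measurable_fun setT (X r)) -> (forall r, measurable_fun setT (Y r)) ->
  measurable_fun setT X' -> measurable_fun setT Y' ->
  (forall r, independent2 P (X r) (Y r)) -> independent2 Q X' Y' ->
  cvg_bounded_lipschitz P Q X X' -> cvg_bounded_lipschitz P Q Y Y' ->
  cvg_bounded_lipschitz P Q (fun r w => col_mx (X r w) (Y r w))
    (fun w => col_mx (X' w) (Y' w)).
Proof.
move=> mX mY mX' mY' indep indep' XX' YY' f M K fM fK.
have mf := lipschitz_measurable_cV fK.
(* the bound below is divided by the constant, so it has to be positive *)
pose K' := `|K| + 1; have K'0 : 0 < K' by rewrite ltr_wpDl.
have fK' u v : `|f u - f v| <= K' * `|u - v|.
  by apply: le_trans (fK u v) _; rewrite ler_wpM2r// (le_trans (ler_norm K))// lerDl.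
have fl u u' y : `|f (col_mx u y) - f (col_mx u' y)| <= K' * `|u - u'|.
  apply: le_trans (fK' _ _) _; rewrite ler_pM2l// opp_col_mx add_col_mx subrr.
  by apply: norm_col_mx_le => //; rewrite normr0.
have fr u y y' : `|f (col_mx u y) - f (col_mx u y')| <= K' * `|y - y'|.
  apply: le_trans (fK' _ _) _; rewrite ler_pM2l// opp_col_mx add_col_mx subrr.
  by apply: norm_col_mx_le => //; rewrite normr0.
have mfl y : measurable_fun setT (fun u => f (col_mx u y)).
  by apply: (@lipschitz_measurable_cV _ _ _ K') => u v; exact: fl.
have mcol : measurable_fun setT (fun z : 'cV[R]_p * 'cV[R]_q => f (col_mx z.1 z.2)).
  by apply: measurableT_comp => //; apply: measurable_col_mx.
have avg d0 (O : measurableType d0) (PP : probability O R) (W : O -> 'cV[R]_p) y y' :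
    measurable_fun setT W ->
    `|\int[PP]_w f (col_mx (W w) y) - \int[PP]_w f (col_mx (W w) y')| <= K' * `|y - y'|.
  move=> mW; apply: (@Rintegral_dist_le _ _ _ PP _ _ M) => //.
  - exact: measurableT_comp (mfl y) mW.
  - exact: measurableT_comp (mfl y') mW.
split.
- by move=> r; apply: measurableT_comp => //; exact: measurable_col_mx.
- by apply: measurableT_comp => //; exact: measurable_col_mx.
have indepE d0 (O : measurableType d0) (PP : probability O R) (W : O -> 'cV[R]_p)
    (W' : O -> 'cV[R]_q) : measurable_fun setT W -> measurable_fun setT W' ->
    independent2 PP W W' -> \int[PP]_w f (col_mx (W w) (W' w)) =
    \int[PP]_w (\int[PP]_w' f (col_mx (W w') (W' w))).
  move=> mW mW' WW'.
  by rewrite (independent2_Rintegral mW mW' WW' mcol (fun z => fM _)).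
under eq_fun do rewrite indepE//.
rewrite indepE//.
apply: (@asymptotic_mapping _ _ _ _ P _ _ Q Y Y'
  (fun r w => \int[P]_w' f (col_mx (X r w') (Y r w)))
  (fun y => \int[Q]_w' f (col_mx (X' w') y)) M) => //.
- move=> r; apply: (@measurableT_comp _ _ _ _ _ _
    (fun y => \int[P]_w' f (col_mx (X r w') y))) => //.
  by apply: (@lipschitz_measurable_cV _ _ _ K') => y y'; exact: avg.
- apply: (@measurableT_comp _ _ _ _ _ _
    (fun y => \int[Q]_w' f (col_mx (X' w') y))) => //.
  by apply: (@lipschitz_measurable_cV _ _ _ K') => y y'; exact: avg.
- move=> r w; apply: Rintegral_norm_le => //.
  exact: measurableT_comp (mfl _) (mX r).
- move=> u; apply: Rintegral_norm_le => //.
  exact: measurableT_comp (mfl _) mX'.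
move=> u e e0; exists (e / 2 / K'); first by rewrite !divr_gt0.
have [_ _ /cvgrPdist_le/(_ (e / 2))] := XX' (fun x => f (col_mx x u)) M K'
  (fun x => fM _) (fun x y => fl x y u).
case; first by rewrite divr_gt0.
move=> k0 _ Hk0; exists k0 => r w kr near_u.
have := Hk0 r kr; have := avg _ _ P (X r) (Y r w) u (mX r).
have : K' * `|Y r w - u| <= e / 2 by rewrite mulrC -ler_pdivlMr// ltW.
move=> a1 a2 /=; rewrite distrC => a3.
rewrite (splitr e); apply: le_trans (ler_distD (\int[P]_w' f (col_mx (X r w') u)) _ _) _.
by rewrite lerD// (le_trans a2).
Qed.

End joint_convergence.

(** * Independence of the two estimators *)

Section independent_sigma_algebras.
Context {R : realType} d (Omega : measurableType d) (P : probability Omega R).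

(** For fixed B, the maps A |-> P(A & B) and A |-> P(A) P(B) are finite measures;
    agreeing on a pi-system with setT, they agree on what it generates. *)
Lemma independent_extension (G : set (set Omega)) (B : set Omega) :
  G `<=` measurable -> setI_closed G -> G setT -> measurable B ->
  (forall A, G A -> P (A `&` B) = (P A * P B)%E) ->
  forall A, <<s G >> A -> P (A `&` B) = (P A * P B)%E.
Proof.
move=> mG GI GT mB GB A sA.
have PB0 : 0 <= fine (P B) by apply: fine_ge0.
have PBE : P B = (fine (P B))%:E by rewrite fineK// fin_num_measure.
transitivity (mscale (NngNum PB0) P A); last by rewrite /mscale/= -PBE muleC.
rewrite -[LHS]/(mrestr P mB A).
apply: (@g_sigma_algebra_measure_unique _ _ _ G mG (fun=> setT)) => //.
- by rewrite bigcup_const.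
- by move=> C GC; rewrite /= /mrestr /mscale/= -PBE muleC; exact: GB.
- move=> _; rewrite /mrestr; apply: le_lt_trans (ltry 1).
  by apply: probability_le1; exact: measurableI.
Qed.

Context (I : eqType) (X : I -> Omega -> R).
Hypothesis mX : forall i, measurable_fun setT (X i).
Hypothesis indX : mutually_independent P X.

(** The pi-system generating the sigma-algebra of the variables with index in J;
    unlike the preimages of single variables, it is stable under
    intersection. *)
Definition finite_cylinders (J : pred I) : set (set Omega) :=
  [set C | exists (s : seq I) (A : I -> set R), [/\ uniq s, all J s,
     forall i, measurable (A i) & C = \bigcap_(i in [set` s]) X i @^-1` A i]].

Lemma finite_cylinders_setT J : finite_cylinders J setT.
Proof.
exists [::], (fun=> setT); split => //.
by rewrite set_nil bigcap_set0.
Qed.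

Lemma finite_cylinders_setI J : setI_closed (finite_cylinders J).
Proof.
move=> _ _ [s [A [us Js mA ->]]] [t [B [ut Jt mB ->]]].
exists (undup (s ++ t)), (fun i => (if i \in s then A i else setT) `&`
                                   (if i \in t then B i else setT)).
split; first exact: undup_uniq.
- by apply/allP => i; rewrite mem_undup mem_cat => /orP[/(allP Js)|/(allP Jt)].
- by move=> i; apply: measurableI; case: ifP.
apply/seteqP; split => [w [sw tw] i _|w stw].
  by split; case: ifP => // iin; [exact: (sw i)|exact: (tw i)].
split => i /= iin.
  have [|+ _] := stw i; first by rewrite /= mem_undup mem_cat iin.
  by rewrite /= iin.
have [|_ +] := stw i; first by rewrite /= mem_undup mem_cat iin orbT.
by rewrite /= iin.
Qed.

Lemma finite_cylinders_measurable J : finite_cylinders J `<=` measurable.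
Proof.
move=> _ [s [A [_ _ mA ->]]].
elim: s => [|i s ih]; first by rewrite set_nil bigcap_set0.
have -> : [set` i :: s] = i |` [set` s].
  apply/seteqP; split => j /=; rewrite inE; first by case/predU1P; [left|right].
  by case=> [->|->]; rewrite ?eqxx ?orbT.
rewrite bigcap_setU1; apply: measurableI => //.
by rewrite -[X in measurable X]setTI; exact: mX.
Qed.

(** Two cylinders with disjoint index sets combine into one cylinder over the
    concatenation of their index lists, to which mutual independence applies. *)
Lemma finite_cylinders_independent (J1 J2 : pred I) A B :
  (forall i, J1 i -> J2 i -> False) ->
  finite_cylinders J1 A -> finite_cylinders J2 B -> P (A `&` B) = (P A * P B)%E.
Proof.
move=> J12 [s [A' [us /allP Js mA' ->]]] [t [B' [ut /allP Jt mB' ->]]].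
pose C i := if i \in s then A' i else B' i.
have ts i : i \in t -> (i \in s) = false.
  by move=> it; apply/negbTE/negP => /Js /J12; apply; exact: Jt.
have ust : uniq (s ++ t).
  rewrite cat_uniq us ut andbT/=; apply/hasPn => i /ts; exact: negbT.
have mC i : measurable (C i) by rewrite /C; case: ifP.
have -> : \bigcap_(i in [set` s]) X i @^-1` A' i = \bigcap_(i in [set` s]) X i @^-1` C i.
  by apply: eq_bigcapr => i /= si; rewrite /C si.
have -> : \bigcap_(i in [set` t]) X i @^-1` B' i = \bigcap_(i in [set` t]) X i @^-1` C i.
  by apply: eq_bigcapr => i /= /ts si; rewrite /C si.
rewrite !indX// -big_cat/= -indX//; congr (P _).
rewrite -bigcap_setU; congr (bigcap _ _).
by apply/seteqP; split => i /=; rewrite mem_cat => /orP.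
Qed.

(** The product rule is extended to the generated sigma-algebras one factor at a
    time. *)
Lemma independent_generated (J1 J2 : pred I) A B :
  (forall i, J1 i -> J2 i -> False) ->
  <<s finite_cylinders J1 >> A -> <<s finite_cylinders J2 >> B ->
  P (A `&` B) = (P A * P B)%E.
Proof.
move=> J12 sA sB.
have mgen J C : <<s finite_cylinders J >> C -> measurable C.
  by apply: smallest_sub; [exact: sigma_algebra_measurable|exact: finite_cylinders_measurable].
apply: (independent_extension (@finite_cylinders_measurable J1)
  (@finite_cylinders_setI J1) (finite_cylinders_setT J1) (mgen _ _ sB) _ sA) => {}A {}sA.
rewrite setIC muleC.
apply: (independent_extension (@finite_cylinders_measurable J2)
  (@finite_cylinders_setI J2) (finite_cylinders_setT J2) _ _ sB) => [|{}B {}sB].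
  exact: finite_cylinders_measurable sA.
by rewrite setIC muleC; exact: finite_cylinders_independent sA sB.
Qed.

End independent_sigma_algebras.

Section independent_estimators.
Context {R : realType} d (Omega : measurableType d) (P : probability Omega R).

(** The observations are the errors shifted by constants, so they carry no
    further information. *)
Lemma sample_sigma_algebra_sub (I : eqType) (X : I -> Omega -> R) (J : pred I)
    k dx p (h : 'I_k * nat -> I) (x : 'I_k -> 'cV[R]_dx)
    (m : 'cV[R]_dx -> 'cV[R]_p -> R) (beta : 'cV[R]_p)
    (eta : 'I_k -> nat -> Omega -> R) (n : nat -> 'I_k -> nat) (r : nat) :
  (forall ij, X (h ij) = eta ij.1 ij.2) -> (forall ij, J (h ij)) ->
  sample_sigma_algebra x m beta eta n r `<=` <<s finite_cylinders X J >>.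
Proof.
move=> Xh Jh; apply: smallest_sub; first exact: smallest_sigma_algebra.
move=> _ [i [j [A [_ mA] ->]]]; apply: sub_sigma_algebra.
exists [:: h (i, j)], (fun=> [set y | A (m (x i) beta + y)]); split => //=.
- by rewrite Jh.
- move=> _; rewrite -[X in measurable X]setTI.
  have : measurable_fun setT (fun y : R => m (x i) beta + y).
    by apply: measurable_funD.
  by move=> /(_ measurableT A mA).
by rewrite set_cons1 bigcap_set1 Xh.
Qed.

Lemma estimators_independent k1 k2 dx p1 p2 (x1 : 'I_k1 -> 'cV[R]_dx)
    (x2 : 'I_k2 -> 'cV[R]_dx) (m1 : 'cV[R]_dx -> 'cV[R]_p1 -> R)
    (m2 : 'cV[R]_dx -> 'cV[R]_p2 -> R) (beta1 : 'cV[R]_p1) (beta2 : 'cV[R]_p2)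
    (eta1 : 'I_k1 -> nat -> Omega -> R) (eta2 : 'I_k2 -> nat -> Omega -> R)
    (n1 : nat -> 'I_k1 -> nat) (n2 : nat -> 'I_k2 -> nat)
    d1 d2 (E1 : measurableType d1) (E2 : measurableType d2)
    (T1 : nat -> Omega -> E1) (T2 : nat -> Omega -> E2) :
  mutually_independent P (pooled eta1 eta2) ->
  (forall i j, measurable_fun setT (eta1 i j)) ->
  (forall i j, measurable_fun setT (eta2 i j)) ->
  estimator x1 m1 beta1 eta1 n1 T1 -> estimator x2 m2 beta2 eta2 n2 T2 ->
  forall r, [/\ measurable_fun setT (T1 r), measurable_fun setT (T2 r) &
                independent2 P (T1 r) (T2 r)].
Proof.
move=> indep me1 me2 eT1 eT2 r.
have mpool i : measurable_fun setT (pooled eta1 eta2 i) by case: i => -[].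
pose J1 (i : 'I_k1 * nat + 'I_k2 * nat) := if i is inl _ then true else false.
pose J2 (i : 'I_k1 * nat + 'I_k2 * nat) := if i is inr _ then true else false.
have s1 A : measurable A ->
    <<s finite_cylinders (pooled eta1 eta2) J1 >> (T1 r @^-1` A).
  by move=> mA; apply: (@sample_sigma_algebra_sub _ _ J1 _ _ _ inl) (eT1 r A mA).
have s2 A : measurable A ->
    <<s finite_cylinders (pooled eta1 eta2) J2 >> (T2 r @^-1` A).
  by move=> mA; apply: (@sample_sigma_algebra_sub _ _ J2 _ _ _ inr) (eT2 r A mA).
have mgen J C : <<s finite_cylinders (pooled eta1 eta2) J >> C -> measurable C.
  apply: smallest_sub; [exact: sigma_algebra_measurable|].
  exact: finite_cylinders_measurable.
split.
- by move=> _ A mA; rewrite setTI; exact: mgen (s1 A mA).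
- by move=> _ A mA; rewrite setTI; exact: mgen (s2 A mA).
- move=> A B mA mB; apply: (independent_generated mpool indep _ (s1 A mA) (s2 B mB)).
  by case.
Qed.

End independent_estimators.

Lemma errors_measurable (R : realType) d (Omega : measurableType d)
    (P : probability Omega R) k (eta : 'I_k -> nat -> Omega -> R) (sigma : R) :
  errors_assumption P eta sigma -> forall i j, measurable_fun setT (eta i j).
Proof. by case=> _ L2 _ _ _ i j; exact: set_mem (sub_Lfun_mfun (L2 i j)). Qed.

(** * Continuity on compact sets *)

Section within_continuity.
Context {R : realType}.

(** The tube lemma: over a compact X, joint continuity makes the modulus of
    continuity in the parameter uniform in x. *)
Lemma compact_tube (E F : normedModType R) (f : E * F -> R) (X : set E)
    (V : set F) (b : F) (e : R) :
  compact X -> {within X `*` V, continuous f} -> V b -> 0 < e ->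
  \forall b' \near b, V b' -> forall x, X x -> `|f (x, b') - f (x, b)| <= e.
Proof.
move=> cX /subspace_continuousP cf Vb e0.
have : near_covering_within X by apply/near_covering_withinP/compact_near_coveringP.
move=> /(_ F (nbhs b) (fun b' x => V b' -> `|f (x, b') - f (x, b)| <= e)) h.
have : \forall b' \near b, X `<=` (fun x => V b' -> `|f (x, b') - f (x, b)| <= e).
  apply: h => x Xx; have e2 : 0 < e / 2 by rewrite divr_gt0.
  have /cvgrPdist_le/(_ _ e2) := cf (x, b) (conj Xx Vb).
  rewrite near_withinE => -[[A B]/= [xA bB] AB].
  exists (A, B) => //= -[x' b'] /= [Ax' Bb'] Xx' Vb'.
  have := AB (x', b) (conj Ax' (nbhs_singleton bB)) (conj Xx' Vb).
  have := AB (x', b') (conj Ax' Bb') (conj Xx' Vb').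
  by rewrite /from_subspace/= !ler_norml => /andP[? ?] /andP[? ?]; apply/andP; split; lra.
by apply: filterS => b' Xb' Vb' x Xx; exact: Xb'.
Qed.

Lemma within_continuous_section (E F : normedModType R) (f : E * F -> R)
    (X : set E) (V : set F) (b : F) :
  {within X `*` V, continuous f} -> V b ->
  {within X, continuous (fun x => f (x, b))}.
Proof.
move=> /subspace_continuousP cf Vb; apply/subspace_continuousP => x Xx.
apply/cvgrPdist_le => e e0.
have /cvgrPdist_le/(_ _ e0) := cf (x, b) (conj Xx Vb).
rewrite !near_withinE => -[[A B]/= [xA bB] AB].
apply: filterS xA => x' Ax' Xx'.
exact: (AB (x', b) (conj Ax' (nbhs_singleton bB)) (conj Xx' Vb)).
Qed.

Lemma within_continuous_trace (E : topologicalType) (L : E -> R) (B : set E)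
    (O : set R) : {within B, continuous L} -> open O ->
  exists2 W : set E, open W & forall b, B b -> (W b <-> O (L b)).
Proof.
move=> /continuousP cL oO; have /open_subspaceP[W oW WB] := cL _ oO.
exists W => // b Bb; have : (W `&` B) b <-> (L @^-1` O `&` B) b by rewrite WB.
rewrite /from_subspace => -[h1 h2].
by split => [Wb|Ob]; [exact: (h1 (conj Wb Bb)).1|exact: (h2 (conj Ob Bb)).1].
Qed.

Lemma within_continuous_measurable_cV p (X : set 'cV[R]_p) (g : 'cV[R]_p -> R) :
  measurable X -> {within X, continuous g} -> measurable_fun X g.
Proof.
move=> mX cg; apply: (measurability _ (measurable_realfun.RGenOpens.measurableE R)).
move=> _ [_ [a [b ->] <-]].
have [W oW WE] := within_continuous_trace cg (@interval_open R (BRight a) (BLeft b) isT isT).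
rewrite (_ : _ `&` _ = X `&` W); last first.
  by apply/seteqP; split => x [Xx xO]; split => //; exact/(WE _ Xx).
by apply: measurableI => //; exact: open_measurable_cV.
Qed.

(** The preimage of an open set under a function continuous on B is the trace on
    B of an open set G, and a map with values in B has the same preimage for
    both. *)
Lemma within_continuous_comp_measurable d (T : measurableType d) p
    (B : set 'cV[R]_p) (L : 'cV[R]_p -> R) (W : T -> 'cV[R]_p) :
  measurable_fun setT W -> (forall t, B (W t)) -> {within B, continuous L} ->
  measurable_fun setT (fun t => L (W t)).
Proof.
move=> mW BW cL; apply: (measurability _ (measurable_realfun.RGenOpens.measurableE R)).
move=> _ [_ [a [b ->] <-]].
have [G oG GE] := within_continuous_trace cL (@interval_open R (BRight a) (BLeft b) isT isT).
rewrite (_ : _ `&` _ = setT `&` W @^-1` G); last first.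
  by apply/seteqP; split => t [_ tO]; split => //; exact/(GE _ (BW t)).
by apply: mW => //; exact: open_measurable_cV.
Qed.

Lemma compact_within_bounded (E : topologicalType) (X : set E) (g : E -> R) :
  compact X -> {within X, continuous g} ->
  exists2 C : R, 0 <= C & forall x, X x -> `|g x| <= C.
Proof.
move=> cX cg; have := continuous_compact cg cX.
move=> /compact_bounded[M [_ HM]]; exists (`|M| + 1); first by rewrite addr_ge0.
move=> x Xx; apply: (HM (`|M| + 1)); last by exists x.
by rewrite ltr_pwDr// ler_norm.
Qed.

End within_continuity.

(** * Lebesgue measure of compact sets *)

Section lebesgue_compact.
Context {R : realType}.

Lemma compact_measurable_cV p (X : set 'cV[R]_p) : compact X -> measurable X.
Proof.
move=> /(compact_closed (@norm_hausdorff _ _)) cX.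
by rewrite -(setCK X); apply: measurableC; apply: open_measurable_cV; exact: closed_openC.
Qed.

Lemma measurable_abs_le (M : R) : measurable [set t : measurableTypeR R | `|t| <= M].
Proof.
rewrite (_ : mkset _ = `[- M, M]%classic); first exact: measurable_itv.
by apply/seteqP; split => t /=; rewrite in_itv/= ler_norml.
Qed.

Lemma measurable_cV_box p (M : R) :
  measurable [set v : 'cV[R]_p | forall i, `|v i ord0| <= M].
Proof.
rewrite (_ : mkset _ = \bigcap_(i in [set: 'I_p]) [set v : 'cV[R]_p | `|v i ord0| <= M]).
  apply: fin_bigcap_measurable => // i _; rewrite -[X in measurable X]setTI.
  exact: (measurable_entry (T := measurableTypeR R) i ord0 measurableT (measurable_abs_le M)).
by apply/seteqP; split => v h i; [move=> _; exact: h|exact: (h i I)].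
Qed.

Lemma lebesgue_cV_box p (M : R) :
  (lebesgue_cV p [set v : 'cV[R]_p | forall i, `|v i ord0| <= M]%R < +oo)%E.
Proof.
elim: p => [|p ih].
  rewrite /lebesgue_cV/= (_ : mkset _ = setT); last first.
    by apply/seteqP; split => // v _ [].
  by rewrite diracT ltry.
have mI := measurable_abs_le M.
have -> : [set v : 'cV[R]_p.+1 | forall i, `|v i ord0| <= M] =
    [set v : 'cV[R]_p.+1 | [set t : R | `|t| <= M] (v ord0 ord0) /\
       [set v : 'cV[R]_p | forall i, `|v i ord0| <= M] (\col_i v (lift ord0 i) ord0)].
  apply/seteqP; split => v /=.
    by move=> h; split => // i; rewrite mxE.
  move=> [h0 h] i; case: (unliftP ord0 i) => [j ->|->//].
  by have := h j; rewrite mxE.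
rewrite [X in (X < _)%E](@cons_measureE R (@lebesgue_measure R) p (lebesgue_cV p) _ _ mI (@measurable_cV_box p M)).
apply: lte_mul_pinfty => //.
  rewrite (_ : mkset _ = `[- M, M]%classic); last first.
    by apply/seteqP; split => t /=; rewrite in_itv/= ler_norml.
  rewrite ge0_fin_numE//= lebesgue_measure_itv/=; case: ifP => _; last exact: ltry.
  by rewrite -EFinB ltry.
Qed.

Lemma lebesgue_cV_compact p (X : set 'cV[R]_p) : compact X ->
  (lebesgue_cV p X < +oo)%E.
Proof.
move=> cX; have mX := compact_measurable_cV cX.
have [M [_ HM]] := compact_bounded cX.
apply: le_lt_trans (lebesgue_cV_box p (`|M| + 1)).
apply: le_measure.
- by rewrite inE.
- by rewrite inE; exact: measurable_cV_box.
- move=> v Xv i; apply: le_trans (mx_entry_le_norm v i ord0) _.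
  by apply: (HM (`|M| + 1)) => //; rewrite ltr_pwDr// ler_norm.
Qed.

Lemma bounded_integrable_compact p (X : set 'cV[R]_p) (g : 'cV[R]_p -> R) (C : R) :
  compact X -> measurable_fun X g -> (forall x, X x -> `|g x| <= C) ->
  (lebesgue_cV p).-integrable X (EFin \o g).
Proof.
move=> cX mg gC; apply: measurable_bounded_integrable => //.
- exact: compact_measurable_cV.
- exact: lebesgue_cV_compact.
- exists C; split; first exact: num_real.
  by move=> y Cy x Xx /=; exact: le_trans (gC x Xx) (ltW Cy).
Qed.

Lemma Rintegral_compact_norm_le p (X : set 'cV[R]_p) (g : 'cV[R]_p -> R) (C : R) :
  compact X -> measurable_fun X g -> (forall x, X x -> `|g x| <= C) ->
  `|\int[lebesgue_cV p]_(x in X) g x| <= C * fine (lebesgue_cV p X).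
Proof.
move=> cX mg gC; have mX := compact_measurable_cV cX.
have Ig := bounded_integrable_compact cX mg gC.
apply: (le_trans (le_normr_Rintegral mX Ig)).
rewrite -(Rintegral_cst _ mX); apply: le_Rintegral => //.
- apply: (bounded_integrable_compact cX (C := C)).
    exact: measurableT_comp.
  by move=> x Xx; rewrite normr_id gC.
- exact: (bounded_integrable_compact cX (C := `|C|)).
Qed.

End lebesgue_compact.

(** * Uniform differentiability in the parameter *)

Section uniform_differentiability.
Context {R : realType}.

Lemma mean_value_bound (f df : R -> R) (c l e : R) :
  (forall t : R, `|t| <= `|c| -> is_derive t 1 f (df t)) ->
  (forall t, `|t| <= `|c| -> `|df t - l| <= e) ->
  `|f c - f 0 - l * c| <= e * `|c|.
Proof.
move=> fdf dfl.
have cont a b : (forall t, t \in `[a, b] -> `|t| <= `|c|) -> {within `[a, b], continuous f}.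
  by move=> abc; apply: derivable_within_continuous => t /abc /fdf [].
have finish t : `|t| <= `|c| -> f c - f 0 = df t * c -> `|f c - f 0 - l * c| <= e * `|c|.
  by move=> tc ->; rewrite -mulrBl normrM ler_wpM2r// dfl.
have [c0|c0] := leP 0 c.
  have inc t : t \in `[0, c] -> `|t| <= `|c|.
    by rewrite in_itv/= => /andP[t0 tc]; rewrite !ger0_norm.
  have [t tin ft] := MVT_segment c0
    (fun t h => fdf t (inc t (subset_itv_oo_cc h))) (cont _ _ inc).
  by apply: (finish t (inc t tin)); rewrite ft subr0.
have inc t : t \in `[c, 0] -> `|t| <= `|c|.
  by rewrite in_itv/= => /andP[ct t0]; rewrite (ler0_norm t0) (ler0_norm (ltW c0)) lerN2.
have [t tin ft] := MVT_segment (ltW c0)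
  (fun t h => fdf t (inc t (subset_itv_oo_cc h))) (cont _ _ inc).
apply: (finish t (inc t tin)); move: ft; rewrite sub0r mulrN => ft.
by rewrite -[LHS]opprB ft opprK.
Qed.

Lemma is_derive_line (V : normedModType R) (f : V -> R) (a v : V) (t : R) :
  derivable f (a + t *: v) v ->
  is_derive t (1 : R) (fun s : R => f (a + s *: v)) ('D_v f (a + t *: v)).
Proof.
have quotE : (fun h : R => h^-1 *: (((fun s : R => f (a + s *: v)) \o shift t) (h *: 1) -
      f (a + t *: v))) =
    (fun h : R => h^-1 *: ((f \o shift (a + t *: v)) (h *: v) - f (a + t *: v))).
  apply/funext => h /=; congr (_ *: (f _ - _)).
  by rewrite scalerDl [h *: 1]mulr1 addrCA addrA.
move=> fd; split; first by rewrite /derivable quotE.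
by rewrite /derive quotE.
Qed.

Lemma dot_colE p (g h : 'cV[R]_p) :
  (g^T *m h) ord0 ord0 = \sum_(i < p) g i ord0 * h i ord0.
Proof. by rewrite mxE; apply: eq_bigr => i _; rewrite mxE. Qed.

(** Partial derivatives that are jointly continuous on X * U vary by at most e'
    over a ball around beta, uniformly in x, by the tube lemma.  Going from beta
    to beta + h one coordinate at a time, the mean value bound controls each of
    the p steps by e' |h i|, and the errors add up. *)
Lemma uniform_taylor d p (X : set 'cV[R]_d) (U : set 'cV[R]_p)
    (m : 'cV[R]_d -> 'cV[R]_p -> R) (beta : 'cV[R]_p) :
  compact X -> open U -> U beta ->
  (forall x b (i : 'I_p), X x -> U b -> derivable (m x) b (delta_mx i ord0)) ->
  (forall i, {within X `*` U, continuous (fun z => partial i (m z.1) z.2)}) ->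
  forall e : R, 0 < e -> exists2 dl : R, 0 < dl & forall h, `|h| < dl ->
    U (beta + h) /\ forall x, X x ->
    `|m x (beta + h) - m x beta - ((gradient (m x) beta)^T *m h) ord0 ord0|
      <= e * `|h|.
Proof.
move=> cX oU Ubeta dm cm e e0; pose e' := e / p.+1%:R.
have e'0 : 0 < e' by rewrite divr_gt0.
have /nbhs_normP[dl /= dl0 Hdl] : \forall b \near beta, U b /\
    forall i x, X x -> `|partial i (m x) b - partial i (m x) beta| <= e'.
  have nU : \forall b \near beta, U b by exact: open_nbhs_nbhs.
  have : \forall b \near beta, forall i, U b -> forall x, X x ->
      `|partial i (m x) b - partial i (m x) beta| <= e'.
    apply: (filter_forall (nbhs_filter beta)) => i.
    exact: (compact_tube (f := fun z => partial i (m z.1) z.2) cX (cm i) Ubeta e'0).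
  by apply: filterS2 nU => b Ub h; split => // i; exact: h.
exists dl => // h hdl; split => [|x Xx].
  by apply: (Hdl (beta + h) _).1; rewrite /= opprD addNKr normrN.
(* path k replaces only the first k coordinates of beta by those of
   beta + h; the segments between successive path points stay in the ball *)
pose path k : 'cV[R]_p := \col_j (if (j < k)%N then h j ord0 else 0).
have path0 : path 0%N = 0 by apply/colP => j; rewrite !mxE.
have pathp : path p = h by apply/colP => j; rewrite !mxE ltn_ord.
have pathS (i : 'I_p) : path i.+1 = path i + h i ord0 *: delta_mx i ord0.
  apply/colP => j; rewrite !mxE eqxx andbT ltnS leq_eqVlt -val_eqE /=.
  by case: eqVneq => [ji|_]; rewrite ?mulr1 ?mulr0 ?addr0// -ji ltnn add0r (val_inj ji).
have near_path (i : 'I_p) t : `|t| <= `|h i ord0| ->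
    `|path i + t *: delta_mx i ord0| < dl.
  move=> th; apply: le_lt_trans hdl; apply: mx_norm_le_entries => // j k.
  rewrite !ord1 !mxE eqxx andbT; case: eqVneq => [->|ji].
    by rewrite ltnn add0r mulr1; apply: le_trans th (mx_entry_le_norm _ _ _).
  rewrite mulr0 addr0; case: ifP => _; first exact: mx_entry_le_norm.
  by rewrite normr0.
have step (i : 'I_p) : `|m x (beta + path i.+1) - m x (beta + path i) -
    partial i (m x) beta * h i ord0| <= e' * `|h i ord0|.
  have inball t : `|t| <= `|h i ord0| -> U (beta + path i + t *: delta_mx i ord0) /\
      forall i0 x, X x -> `|partial i0 (m x) (beta + path i + t *: delta_mx i ord0)
        - partial i0 (m x) beta| <= e'.
    move=> /near_path th; apply: Hdl => /=.
    by rewrite -addrA opprD addNKr normrN.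
  have := @mean_value_bound (fun t => m x (beta + path i + t *: delta_mx i ord0))
    (fun t => partial i (m x) (beta + path i + t *: delta_mx i ord0))
    (h i ord0) (partial i (m x) beta) e'.
  rewrite scale0r addr0 -[X in m x X](addrA beta) -pathS; apply.
    by move=> t /inball[Ub _]; apply: is_derive_line; exact: dm.
  by move=> t /inball[_]; exact.
rewrite dot_colE.
have -> : m x (beta + h) - m x beta = \sum_(i < p) (m x (beta + path i.+1) - m x (beta + path i)).
  rewrite -[LHS](_ : m x (beta + path p) - m x (beta + path 0%N) = _); last first.
    by rewrite pathp path0 addr0.
  by rewrite -(telescope_sumr (fun k => m x (beta + path k)) (leq0n p)) big_mkord.
rewrite -sumrB; apply: le_trans (ler_norm_sum _ _ _) _.
apply: (@le_trans _ _ (\sum_(i < p) e' * `|h|)).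
  apply: ler_sum => i _; rewrite mxE; apply: le_trans (step i) _.
  by rewrite ler_pM2l// mx_entry_le_norm.
rewrite sumr_const card_ord -mulr_natr mulrAC ler_wpM2r//.
by rewrite /e' mulrAC ler_pdivrMr// ler_pM2l// ler_nat.
Qed.

End uniform_differentiability.

(** * The directional derivative of the absolute value and of the L1 norm *)

Section absolute_value_derivative.
Context {R : realType}.

(** The one-sided derivative of the absolute value at D in the direction g; only
    at D = 0 does it fail to be linear in g. *)
Definition abs_derivative (D g : R) : R :=
  if D == 0 then `|g| else Num.sg D * g.

Lemma abs_derivative_dist_le (D g g' : R) :
  `|abs_derivative D g - abs_derivative D g'| <= `|g - g'|.
Proof.
rewrite /abs_derivative; case: eqVneq => [_|D0]; first exact: ler_dist_dist.
by rewrite -mulrBr normrM normr_sg D0 mul1r.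
Qed.

Lemma norm_abs_derivative_le (D g : R) : `|abs_derivative D g| <= `|g|.
Proof.
rewrite /abs_derivative; case: eqVneq => [_|D0]; first by rewrite normr_id.
by rewrite normrM normr_sg D0 mul1r.
Qed.

Lemma abs_quotient_dist_le (a D y y' : R) :
  `|a * (`|D + y / a| - `|D|) - a * (`|D + y' / a| - `|D|)| <= `|y - y'|.
Proof.
rewrite -mulrBr opprB addrA subrK normrM.
have [->|a0] := eqVneq a 0; first by rewrite normr0 mul0r.
apply: (@le_trans _ _ (`|a| * `|(y - y') / a|)).
  rewrite ler_wpM2l//; apply: le_trans (ler_dist_dist _ _) _.
  by rewrite opprD addrACA subrr add0r -mulrBl.
by rewrite normrM normfV mulrC mulfVK// normr_eq0.
Qed.

Lemma norm_abs_quotient_le (a D y : R) : `|a * (`|D + y / a| - `|D|)| <= `|y|.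
Proof.
have := abs_quotient_dist_le a D y 0.
by rewrite mul0r addr0 subrr mulr0 !subr0.
Qed.

(** The quotient is in fact eventually equal to its limit: as soon as
    |g| / a r <= |D|, the sum D + g / a r has the sign of D. *)
Lemma abs_quotient_cvg (a : nat -> R) (D g : R) :
  a r @[r --> \oo] --> +oo ->
  a r * (`|D + g / a r| - `|D|) @[r --> \oo] --> abs_derivative D g.
Proof.
move=> /cvgryPge ay; apply: cvg_near_cst.
rewrite /abs_derivative; case: eqVneq => [->|D0].
  near=> r; have ar : 1 <= a r by near: r; exact: ay.
  have a0 : 0 < a r by apply: lt_le_trans ar.
  by rewrite add0r normr0 subr0 normrM normfV (gtr0_norm a0) mulrC divfK// gt_eqF.
near=> r; have ar : 1 <= a r by near: r; exact: ay.
have ar2 : `|g| / `|D| <= a r by near: r; exact: ay.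
have a0 : 0 < a r by apply: lt_le_trans ar.
have a0' : a r != 0 by rewrite gt_eqF.
have small : `|g / a r| <= `|D|.
  rewrite normrM normfV (gtr0_norm a0) ler_pdivrMr// mulrC.
  by rewrite -ler_pdivrMr ?normr_gt0.
have -> : `|D + g / a r| - `|D| = Num.sg D * (g / a r).
  move: small; rewrite ler_norml; case: (ltgtP D 0) D0 => // [Dn _|Dp _] /andP[h1 h2].
    move: h1 h2; rewrite (ltr0_norm Dn) ltr0_sg// => h1 h2.
    by rewrite ler0_norm; lra.
  move: h1 h2; rewrite (gtr0_norm Dp) gtr0_sg// => h1 h2.
  by rewrite ger0_norm; lra.
by rewrite mulrCA [a r * _]mulrC divfK.
Unshelve. all: by end_near.
Qed.

End absolute_value_derivative.

Section L1_directional_derivative.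
Context {R : realType} {d : nat}.
Variables (X : set 'cV[R]_d) (D : 'cV[R]_d -> R).
Hypotheses (cX : compact X) (mD : measurable_fun X D).
Let mX : measurable X := compact_measurable_cV cX.
Let mu := lebesgue_cV (R := R) d.

Lemma measurable_abs_quotient (a : R) (g : 'cV[R]_d -> R) :
  measurable_fun X g -> measurable_fun X (fun x => a * (`|D x + g x / a| - `|D x|)).
Proof.
move=> mg; apply: measurable_funM => //; apply: measurable_funB.
  apply: measurableT_comp => //; apply: measurable_funD => //.
  exact: measurable_funM.
exact: measurableT_comp.
Qed.

Lemma measurable_abs_derivative (g : 'cV[R]_d -> R) :
  measurable_fun X g -> measurable_fun X (fun x => abs_derivative (D x) (g x)).
Proof.
move=> mg; pose a (r : nat) : R := r%:R.
apply: (@measurable_fun_cvg _ _ _ X (fun r x => a r * (`|D x + g x / a r| - `|D x|))).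
  by move=> r; exact: measurable_abs_quotient.
by move=> x _; apply: abs_quotient_cvg; exact: cvgr_idn.
Qed.

(** Dominated convergence, with dominating constant C: the quotients are bounded
    by |g|, and X has finite measure. *)
Lemma Rintegral_abs_quotient_cvg (a : nat -> R) (g : 'cV[R]_d -> R) (C : R) :
  measurable_fun X g -> (forall x, X x -> `|g x| <= C) ->
  a r @[r --> \oo] --> +oo ->
  \int[mu]_(x in X) (a r * (`|D x + g x / a r| - `|D x|)) @[r --> \oo] -->
  \int[mu]_(x in X) abs_derivative (D x) (g x).
Proof.
move=> mg gC ay.
have habs := measurable_abs_derivative mg.
have Iabs : mu.-integrable X (EFin \o (fun x => abs_derivative (D x) (g x))).
  apply: (bounded_integrable_compact cX habs (C := C)) => x Xx.
  exact: le_trans (norm_abs_derivative_le _ _) (gC x Xx).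
apply: fine_cvg; rewrite /Rintegral fineK; last exact: integrable_fin_num.
apply: (@dominated_cvg _ _ _ mu X mX _ _ (fun=> C%:E)) => //.
- by move=> r; apply/measurable_EFinP; exact: measurable_abs_quotient.
- move=> x Xx; apply: cvg_EFin; first by near=> r.
  exact: abs_quotient_cvg.
- exact: (bounded_integrable_compact cX (g := fun=> C) (C := `|C|)).
- move=> r x Xx; rewrite lee_fin.
  exact: le_trans (norm_abs_quotient_le _ _ _) (gC x Xx).
Unshelve. all: by end_near.
Qed.

Lemma Rintegral_abs_derivativeE (g : 'cV[R]_d -> R) (C : R) :
  measurable_fun X g -> (forall x, X x -> `|g x| <= C) ->
  \int[mu]_(x in X `\` [set x | X x /\ D x = 0]) (Num.sg (D x) * g x) +
    \int[mu]_(x in [set x | X x /\ D x = 0]) `|g x| =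
  \int[mu]_(x in X) abs_derivative (D x) (g x).
Proof.
move=> mg gC; set N := [set x | X x /\ D x = 0].
have mN : measurable N.
  rewrite (_ : N = X `&` D @^-1` [set 0]); last by apply/seteqP; split.
  by apply: mD.
have NX : N `<=` X by move=> x [].
have XE : X = (X `\` N) `|` N by rewrite setDKU.
have Iabs : mu.-integrable X (EFin \o (fun x => abs_derivative (D x) (g x))).
  apply: (bounded_integrable_compact cX (C := C)); first exact: measurable_abs_derivative.
  move=> x Xx; exact: le_trans (norm_abs_derivative_le _ _) (gC x Xx).
rewrite [in RHS]XE Rintegral_setU//; last 3 first.
- exact: measurableD.
- by rewrite -XE.
- by apply/disj_setPS => x [[_ nNx] Nx].
congr (_ + _); apply: eq_Rintegral => x; rewrite inE => -[].
  move=> Xx nN; rewrite /abs_derivative ifF//; apply/eqP => D0.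
  by apply: nN.
by move=> _ ->; rewrite /abs_derivative eqxx.
Qed.

End L1_directional_derivative.

(** * Scaled increments of one regression function *)

Section scaled_increments.
Context {R : realType} {d p : nat}.
Variables (X : set 'cV[R]_d) (U : set 'cV[R]_p).
Variables (m : 'cV[R]_d -> 'cV[R]_p -> R) (beta : 'cV[R]_p).
Hypotheses (cX : compact X) (oU : open U) (Ubeta : U beta).
Hypothesis smooth : C2_in_parameter X U m.

Let dot x (u : 'cV[R]_p) : R := ((gradient (m x) beta)^T *m u) ord0 ord0.

Lemma measurable_parameter_section (V : set 'cV[R]_p) (b : 'cV[R]_p) :
  C2_in_parameter X V m -> V b -> measurable_fun X (m ^~ b).
Proof.
case=> _ _ cm _ _ Vb.
apply: within_continuous_measurable_cV; first exact: compact_measurable_cV.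
exact: (within_continuous_section cm Vb).
Qed.

Lemma bounded_parameter_section (V : set 'cV[R]_p) (b : 'cV[R]_p) :
  C2_in_parameter X V m -> V b -> exists C : R, forall x, X x -> `|m x b| <= C.
Proof.
case=> _ _ cm _ _ Vb.
have [C _ HC] := compact_within_bounded cX (within_continuous_section cm Vb).
by exists C.
Qed.

Lemma measurable_gradient_dot (u : 'cV[R]_p) : measurable_fun X (dot ^~ u).
Proof.
rewrite /dot; under eq_fun do rewrite dot_colE.
apply: measurable_sum => i; apply: measurable_funM => //.
under eq_fun do rewrite mxE.
apply: within_continuous_measurable_cV; first exact: compact_measurable_cV.
have [_ _ _ cd _] := smooth.
exact: (within_continuous_section (cd i) Ubeta).
Qed.

Lemma gradient_dot_bounded : exists2 C : R, 0 <= C &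
  forall x u, X x -> `|dot x u| <= C * `|u|.
Proof.
have [_ _ _ cd _] := smooth.
have bnd i : exists C : R, 0 <= C /\ forall x, X x -> `|partial i (m x) beta| <= C.
  have [C C0 HC] := compact_within_bounded cX (within_continuous_section (cd i) Ubeta).
  by exists C.
have [C HC] := choice bnd; exists (\sum_i C i).
  by apply: sumr_ge0 => i _; have [] := HC i.
move=> x u Xx; rewrite /dot dot_colE mulr_suml.
apply: le_trans (ler_norm_sum _ _ _) _; apply: ler_sum => i _.
rewrite normrM mxE; apply: ler_pM => //; last exact: mx_entry_le_norm.
by have [_] := HC i; apply.
Qed.

Lemma gradient_dotB x u v : dot x (u - v) = dot x u - dot x v.
Proof. by rewrite /dot mulmxBr !mxE. Qed.

(** With a = sqrt n_l and c = sqrt (n / n_l), the scaled increment at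
    beta + v / a is c times the gradient applied to v, up to the Taylor
    remainder.  It is uniformly close to c0 times the gradient at u because v is
    close to u, c r is close to c0, and the remainder is small relative to
    v / a. *)
Lemma scaled_taylor (a c : nat -> R) (c0 : R) :
  a r @[r --> \oo] --> +oo -> c r @[r --> \oo] --> c0 ->
  forall (u : 'cV[R]_p) (e : R), 0 < e -> exists2 dl : R, 0 < dl &
  exists K, forall r v, (K <= r)%N -> `|v - u| < dl ->
    U (beta + (a r)^-1 *: v) /\ forall x, X x ->
    `|c r * (a r * (m x (beta + (a r)^-1 *: v) - m x beta)) - c0 * dot x u| <= e.
Proof.
move=> /cvgryPge ay cc0 u e e0.
have [C C0 HC] := gradient_dot_bounded.
(* the error splits into the Taylor remainder, the error in c and the error
   in u; eT, s and dl are chosen so that each is at most e / 3 *)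
pose M := `|u| + 1; have M0 : 0 < M by rewrite ltr_wpDl.
pose k := `|c0| + 1; have k0 : 0 < k by rewrite ltr_wpDl.
pose eT := e / 3 / (k * M); have eT0 : 0 < eT by rewrite !divr_gt0// mulr_gt0.
have [dm _ _ cd _] := smooth.
have [dT dT0 taylor] := uniform_taylor cX oU Ubeta dm cd eT0.
pose dl := Num.min 1 (e / 3 / (k * (C + 1))).
have kC0 : 0 < k * (C + 1) by rewrite mulr_gt0// ltr_wpDl.
have dl0 : 0 < dl by rewrite lt_min ltr01 !divr_gt0.
pose s := e / 3 / ((C + 1) * M).
have s0 : 0 < s by rewrite !divr_gt0// mulr_gt0// ltr_wpDl.
exists dl => //.
have : \forall r \near \oo, [/\ 1 <= a r, M / dT + 1 <= a r, `|c0 - c r| <= s & `|c r| <= k].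
  near=> r; split.
  - by near: r; exact: ay.
  - by near: r; exact: ay.
  - by near: r; move/cvgrPdist_le : cc0; exact.
  - have : `|c0 - c r| <= 1 by near: r; move/cvgrPdist_le : cc0; exact.
    move=> h; rewrite -(subrK c0 (c r)); apply: le_trans (ler_normD _ _) _.
    by rewrite distrC addrC lerD2l.
move=> [K _ HK]; exists K => r v Kr; rewrite lt_min => /andP[vu1 vu2].
have [a1 aM cs ck] := HK r Kr.
have a0 : 0 < a r by apply: lt_le_trans a1.
have vM : `|v| <= M.
  rewrite -(subrK u v); apply: le_trans (ler_normD _ _) _.
  by rewrite addrC lerD2l ltW.
have small : `|(a r)^-1 *: v| < dT.
  rewrite normrZ normfV (gtr0_norm a0) mulrC ltr_pdivrMr//.
  apply: le_lt_trans vM _; rewrite -ltr_pdivrMl// mulrC.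
  by apply: lt_le_trans aM; rewrite ltrDl.
have [Ub Tb] := taylor _ small; split => // x Xx.
have := Tb x Xx.
have -> : ((gradient (m x) beta)^T *m ((a r)^-1 *: v)) ord0 ord0 = (a r)^-1 * dot x v.
  by rewrite -scalemxAr mxE.
set inc := m x _ - m x beta => Tx.
have E1 : c r * (a r * inc) - c0 * dot x u =
    c r * (a r * (inc - (a r)^-1 * dot x v)) + (c r - c0) * dot x v + c0 * dot x (v - u).
  rewrite gradient_dotB; field; exact: lt0r_neq0.
have t1 : `|c r * (a r * (inc - (a r)^-1 * dot x v))| <= e / 3.
  rewrite !normrM (gtr0_norm a0).
  have : a r * `|inc - (a r)^-1 * dot x v| <= eT * `|v|.
    apply: le_trans (ler_wpM2l (ltW a0) Tx) _.
    by rewrite normrZ normfV (gtr0_norm a0) mulrCA mulVKf ?gt_eqF.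
  move=> h; apply: (@le_trans _ _ (k * (eT * M))).
    apply: ler_pM => //; first by rewrite mulr_ge0// ltW.
    by apply: le_trans h _; rewrite ler_pM2l.
  rewrite /eT [leLHS](_ : _ = e / 3)//.
  by field; rewrite !gt_eqF.
have t2 : `|(c r - c0) * dot x v| <= e / 3.
  rewrite normrM distrC; apply: (@le_trans _ _ (s * ((C + 1) * M))).
    apply: ler_pM => //; apply: le_trans (HC x v Xx) _.
    by apply: ler_pM => //; rewrite lerDl.
  by rewrite /s divfK// mulf_neq0// gt_eqF// ltr_wpDl.
have t3 : `|c0 * dot x (v - u)| <= e / 3.
  rewrite normrM; apply: (@le_trans _ _ (k * ((C + 1) * (e / 3 / (k * (C + 1)))))).
    apply: ler_pM => //; first by rewrite lerDl.
    apply: le_trans (HC x _ Xx) _; apply: ler_pM => //; first by rewrite lerDl.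
    exact: ltW.
  rewrite [leLHS](_ : _ = e / 3)//; have C1 : 0 < C + 1 by rewrite ltr_wpDl.
  by field; rewrite !gt_eqF.
rewrite E1; apply: le_trans (ler_normD _ _) _.
apply: (@le_trans _ _ (e / 3 + e / 3 + e / 3)); last by lra.
by rewrite lerD//; apply: le_trans (ler_normD _ _) _; rewrite lerD.
Unshelve. all: by end_near.
Qed.

End scaled_increments.

(** * The L1-distance of the two regression functions *)

Section two_sample_distance.
Context {R : realType} {d p1 p2 : nat}.
Variables (X : set 'cV[R]_d).
Variables (m1 : 'cV[R]_d -> 'cV[R]_p1 -> R) (m2 : 'cV[R]_d -> 'cV[R]_p2 -> R).
Hypothesis cX : compact X.
Let mX : measurable X := compact_measurable_cV cX.
Let mu := lebesgue_cV (R := R) d.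
Let lambda := fine (mu X).
Let lambda_ge0 : 0 <= lambda. Proof. exact: fine_ge0. Qed.

Section difference.
Variables (V1 : set 'cV[R]_p1) (V2 : set 'cV[R]_p2).
Hypotheses (s1 : C2_in_parameter X V1 m1) (s2 : C2_in_parameter X V2 m2).

Lemma measurable_regression_difference b1 b2 : V1 b1 -> V2 b2 ->
  measurable_fun X (fun x => m1 x b1 - m2 x b2).
Proof.
move=> Vb1 Vb2.
exact: measurable_funB (measurable_parameter_section cX s1 Vb1)
                       (measurable_parameter_section cX s2 Vb2).
Qed.

Lemma integrable_regression_distance b1 b2 : V1 b1 -> V2 b2 ->
  mu.-integrable X (EFin \o (fun x => `|m1 x b1 - m2 x b2|)).
Proof.
move=> Vb1 Vb2; have [C1 HC1] := bounded_parameter_section cX s1 Vb1.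
have [C2 HC2] := bounded_parameter_section cX s2 Vb2.
apply: (bounded_integrable_compact cX (C := C1 + C2)).
  exact: measurableT_comp (measurable_regression_difference Vb1 Vb2).
move=> x Xx; rewrite normr_id; apply: le_trans (ler_normB _ _) _.
by rewrite lerD ?HC1 ?HC2.
Qed.

Lemma L1_distance_dist_le b1 b2 b1' b2' (e : R) :
  V1 b1 -> V2 b2 -> V1 b1' -> V2 b2' ->
  (forall x, X x -> `|m1 x b1 - m1 x b1'| <= e) ->
  (forall x, X x -> `|m2 x b2 - m2 x b2'| <= e) ->
  `|L1_distance X m1 m2 b1 b2 - L1_distance X m1 m2 b1' b2'| <= (e + e) * lambda.
Proof.
move=> Vb1 Vb2 Vb1' Vb2' h1 h2; rewrite /L1_distance.
rewrite -(RintegralB mX (integrable_regression_distance Vb1 Vb2)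
  (integrable_regression_distance Vb1' Vb2')).
apply: Rintegral_compact_norm_le => //.
  by apply: measurable_funB; apply: measurableT_comp => //;
    exact: measurable_regression_difference.
move=> x Xx; apply: le_trans (ler_dist_dist _ _) _.
rewrite (_ : _ - _ = (m1 x b1 - m1 x b1') - (m2 x b2 - m2 x b2')); last by ring.
by apply: le_trans (ler_normB _ _) _; rewrite lerD ?h1 ?h2.
Qed.

(** With V_l the parameter set in which the estimators take their values, this
    gives the measurability of the estimated distance. *)
Lemma L1_distance_within_continuous :
  {within [set b : 'cV[R]_(p1 + p2) | V1 (usubmx b) /\ V2 (dsubmx b)],
    continuous (fun b => L1_distance X m1 m2 (usubmx b) (dsubmx b))}.
Proof.
apply/subspace_continuousP => b [Vb1 Vb2]; apply/cvgrPdist_le => e e0.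
pose e' := e / 2 / (lambda + 1).
have l1 : 0 < lambda + 1 by rewrite ltr_wpDl.
have e'0 : 0 < e' by rewrite !divr_gt0.
have [_ _ c1 _ _] := s1; have [_ _ c2 _ _] := s2.
have cu : (usubmx : 'cV[R]_(p1 + p2) -> _) b' @[b' --> b] --> usubmx b.
  apply: (@lipschitz_is_continuous _ _ _ _ 1) => u v.
  by rewrite mul1r -linearB norm_usubmx_le.
have cd : (dsubmx : 'cV[R]_(p1 + p2) -> _) b' @[b' --> b] --> dsubmx b.
  apply: (@lipschitz_is_continuous _ _ _ _ 1) => u v.
  by rewrite mul1r -linearB norm_dsubmx_le.
have t1 := cu _ (compact_tube cX c1 Vb1 e'0).
have t2 := cd _ (compact_tube cX c2 Vb2 e'0).
rewrite near_withinE; near=> b' => -[Vb1' Vb2'].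
have h1 : V1 (usubmx b') -> forall x, X x -> `|m1 x (usubmx b') - m1 x (usubmx b)| <= e'.
  by near: b'; exact: t1.
have h2 : V2 (dsubmx b') -> forall x, X x -> `|m2 x (dsubmx b') - m2 x (dsubmx b)| <= e'.
  by near: b'; exact: t2.
rewrite distrC.
apply: (le_trans (L1_distance_dist_le Vb1' Vb2' Vb1 Vb2 (h1 Vb1') (h2 Vb2'))).
rewrite -[leRHS](_ : (e' + e') * (lambda + 1) = e); last first.
  by rewrite /e'; field; rewrite gt_eqF.
by rewrite ler_wpM2l ?lerDl// addr_ge0// ltW.
Unshelve. all: by end_near.
Qed.

End difference.

Variables (beta1 : 'cV[R]_p1) (beta2 : 'cV[R]_p2).
Variables (U1 : set 'cV[R]_p1) (U2 : set 'cV[R]_p2).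
Hypotheses (oU1 : open U1) (oU2 : open U2) (Ub1 : U1 beta1) (Ub2 : U2 beta2).
Hypotheses (s1 : C2_in_parameter X U1 m1) (s2 : C2_in_parameter X U2 m2).
Variables (kappa1 kappa2 : R).

(** The path of the limit process, with both scaled estimation errors collected
    in one column vector. *)
Definition limit_path (u : 'cV[R]_(p1 + p2)) (x : 'cV[R]_d) : R :=
  kappa1 * ((gradient (m1 x) beta1)^T *m usubmx u) ord0 ord0 -
  kappa2 * ((gradient (m2 x) beta2)^T *m dsubmx u) ord0 ord0.

Let D x := m1 x beta1 - m2 x beta2.
Let mD : measurable_fun X D := measurable_regression_difference s1 s2 Ub1 Ub2.

Lemma measurable_limit_path u : measurable_fun X (limit_path u).
Proof.
apply: measurable_funB; apply: measurable_funM => //.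
  exact: (measurable_gradient_dot cX Ub1 s1).
exact: (measurable_gradient_dot cX Ub2 s2).
Qed.

Lemma limit_path_lipschitz : exists2 C : R, 0 <= C & forall u v x, X x ->
  `|limit_path u x - limit_path v x| <= C * `|u - v|.
Proof.
have [C1 C10 HC1] := gradient_dot_bounded cX Ub1 s1.
have [C2 C20 HC2] := gradient_dot_bounded cX Ub2 s2.
exists (`|kappa1| * C1 + `|kappa2| * C2); first by rewrite addr_ge0// mulr_ge0.
move=> u v x Xx; rewrite /limit_path.
rewrite (_ : _ - _ = kappa1 * ((gradient (m1 x) beta1)^T *m usubmx (u - v)) ord0 ord0 -
  kappa2 * ((gradient (m2 x) beta2)^T *m dsubmx (u - v)) ord0 ord0); last first.
  by rewrite !linearB/= !mxE; ring.
apply: le_trans (ler_normB _ _) _; rewrite !normrM mulrDl -!mulrA lerD//.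
  rewrite ler_wpM2l//; apply: le_trans (HC1 _ _ Xx) _.
  by rewrite ler_wpM2l// norm_usubmx_le.
rewrite ler_wpM2l//; apply: le_trans (HC2 _ _ Xx) _.
by rewrite ler_wpM2l// norm_dsubmx_le.
Qed.

Lemma limit_path_bounded u : exists C : R, forall x, X x -> `|limit_path u x| <= C.
Proof.
have [C C0 HC] := limit_path_lipschitz; exists (C * `|u|) => x Xx.
have := HC u 0 x Xx; rewrite subr0; congr (`|_| <= _).
by rewrite /limit_path !linear0 !mxE !mulr0 !subr0.
Qed.

(** Both integrals of the limit functional are those of one function over X, which
    makes it Lipschitz in u and a limit of difference quotients. *)
Lemma limit_functionalE u :
  limit_functional X m1 m2 beta1 beta2 (limit_path u) =
  \int[mu]_(x in X) abs_derivative (D x) (limit_path u x).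
Proof.
have [C HC] := limit_path_bounded u.
exact: (Rintegral_abs_derivativeE cX mD (measurable_limit_path u) HC).
Qed.

Lemma limit_functional_continuous :
  continuous (fun u => limit_functional X m1 m2 beta1 beta2 (limit_path u)).
Proof.
have [C C0 HC] := limit_path_lipschitz.
apply: (@lipschitz_is_continuous _ _ _ _ (C * lambda)) => u v.
have Iabs w : mu.-integrable X (EFin \o (fun x => abs_derivative (D x) (limit_path w x))).
  have [K HK] := limit_path_bounded w.
  apply: (bounded_integrable_compact cX (C := K)).
    exact: (measurable_abs_derivative mD (measurable_limit_path w)).
  move=> x Xx; exact: le_trans (norm_abs_derivative_le _ _) (HK x Xx).
rewrite !limit_functionalE -(RintegralB mX (Iabs u) (Iabs v)) mulrAC.
apply: Rintegral_compact_norm_le => //.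
  by apply: measurable_funB; apply: (measurable_abs_derivative mD);
    exact: measurable_limit_path.
move=> x Xx; apply: le_trans (abs_derivative_dist_le _ _ _) _; exact: HC.
Qed.

(** Let q be the scaled increment of the difference D of the regression
    functions.  The scaled increment of the distance is the integral of the
    difference quotient of the absolute value at D along q.  By the uniform
    Taylor expansion q is within 2 e' of the limit path on X, and difference
    quotients are 1-Lipschitz in the direction; so q may be replaced by the limit
    path, along which the quotients converge. *)
Lemma L1_distance_delta (a a1 a2 : nat -> R) :
  a r @[r --> \oo] --> +oo -> a1 r @[r --> \oo] --> +oo ->
  a2 r @[r --> \oo] --> +oo ->
  a r / a1 r @[r --> \oo] --> kappa1 -> a r / a2 r @[r --> \oo] --> kappa2 ->
  forall (u : 'cV[R]_(p1 + p2)) (e : R), 0 < e -> exists2 dl : R, 0 < dl &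
  exists K, forall r v, (K <= r)%N -> `|v - u| < dl ->
    `|a r * (L1_distance X m1 m2 (beta1 + (a1 r)^-1 *: usubmx v)
                                 (beta2 + (a2 r)^-1 *: dsubmx v) -
             L1_distance X m1 m2 beta1 beta2) -
      limit_functional X m1 m2 beta1 beta2 (limit_path u)| <= e.
Proof.
move=> ay a1y a2y ak1 ak2 u e e0.
pose e' := e / 4 / (lambda + 1).
have l1 : 0 < lambda + 1 by rewrite ltr_wpDl.
have e'0 : 0 < e' by rewrite !divr_gt0.
have [dl1 dl10 [K1 HK1]] := scaled_taylor cX oU1 Ub1 s1 a1y ak1 (usubmx u) e'0.
have [dl2 dl20 [K2 HK2]] := scaled_taylor cX oU2 Ub2 s2 a2y ak2 (dsubmx u) e'0.
have [C HC] := limit_path_bounded u.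
have mg := measurable_limit_path u.
have e2 : 0 < e / 2 by rewrite divr_gt0.
have /cvgrPdist_le/(_ _ e2)[K3 _ HK3] := Rintegral_abs_quotient_cvg cX mD mg HC ay.
have [K4 _ HK4] : \forall r \near \oo, [/\ 0 < a r, 0 < a1 r & 0 < a2 r].
  near=> r; split; near: r.
  - by move/cvgryPgt : ay; exact.
  - by move/cvgryPgt : a1y; exact.
  - by move/cvgryPgt : a2y; exact.
exists (Num.min dl1 dl2); first by rewrite lt_min dl10 dl20.
exists (maxn (maxn K1 K2) (maxn K3 K4)) => r v.
rewrite !geq_max => /andP[/andP[K1r K2r] /andP[K3r K4r]].
rewrite lt_min => /andP[vu1 vu2].
have [a0 a10 a20] := HK4 r K4r.
have [Ub1' T1] := HK1 r (usubmx v) K1r (le_lt_trans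
  (eq_ind _ (fun t => `|t| <= `|v - u|) (norm_usubmx_le (v - u)) _ (linearB _ v u)) vu1).
have [Ub2' T2] := HK2 r (dsubmx v) K2r (le_lt_trans
  (eq_ind _ (fun t => `|t| <= `|v - u|) (norm_dsubmx_le (v - u)) _ (linearB _ v u)) vu2).
set b1 := beta1 + _ in Ub1' T1 *; set b2 := beta2 + _ in Ub2' T2 *.
pose q x := a r * ((m1 x b1 - m2 x b2) - D x).
have mq : measurable_fun X q.
  apply: measurable_funM => //; apply: measurable_funB => //.
  exact: (measurable_regression_difference s1 s2).
have qg x : X x -> `|q x - limit_path u x| <= e' + e'.
  move=> Xx; have := T1 x Xx; have := T2 x Xx.
  rewrite !mulrA !divfK ?gt_eqF// => t2 t1.
  rewrite /q /limit_path /D (_ : _ - _ =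
    (a r * (m1 x b1 - m1 x beta1) - kappa1 * ((gradient (m1 x) beta1)^T *m usubmx u) ord0 ord0) -
    (a r * (m2 x b2 - m2 x beta2) - kappa2 * ((gradient (m2 x) beta2)^T *m dsubmx u) ord0 ord0));
    last by ring.
  by apply: le_trans (ler_normB _ _) _; rewrite lerD.
have Iq (h : 'cV[R]_d -> R) (K : R) : measurable_fun X h ->
    (forall x, X x -> `|h x| <= K) ->
    mu.-integrable X (EFin \o (fun x => a r * (`|D x + h x / a r| - `|D x|))).
  move=> mh hK; apply: (bounded_integrable_compact cX (C := K)).
    exact: measurable_abs_quotient.
  move=> x Xx; exact: le_trans (norm_abs_quotient_le _ _ _) (hK x Xx).
have q_bounded x : X x -> `|q x| <= C + (e' + e').
  move=> Xx; rewrite -(subrK (limit_path u x) (q x)).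
  by apply: le_trans (ler_normD _ _) _; rewrite addrC lerD ?HC ?qg.
have L1E : a r * (L1_distance X m1 m2 b1 b2 - L1_distance X m1 m2 beta1 beta2) =
    \int[mu]_(x in X) (a r * (`|D x + q x / a r| - `|D x|)).
  have Ib := integrable_regression_distance s1 s2 Ub1' Ub2'.
  have I0 := integrable_regression_distance s1 s2 Ub1 Ub2.
  rewrite /L1_distance -(RintegralB mX Ib I0) -(RintegralZl _ mX); last first.
    exact: (integrableB mX Ib I0).
  apply: eq_Rintegral => x _; congr (_ * (`|_| - _)).
  by rewrite /q /D; field; rewrite gt_eqF.
rewrite L1E limit_functionalE.
apply: le_trans (ler_distD (\int[mu]_(x in X) (a r * (`|D x + limit_path u x / a r| - `|D x|))) _ _) _.
rewrite (splitr e) lerD//; last by have := HK3 r K3r; rewrite /= distrC.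
rewrite -(RintegralB mX (Iq _ _ mq q_bounded) (Iq _ _ mg HC)).
apply: (@le_trans _ _ ((e' + e') * lambda)).
  apply: Rintegral_compact_norm_le => //.
    by apply: measurable_funB; exact: measurable_abs_quotient.
  by move=> x Xx; apply: le_trans (abs_quotient_dist_le _ _ _ _) _; exact: qg.
rewrite -[leRHS](_ : (e' + e') * (lambda + 1) = e / 2); last first.
  by rewrite /e'; field; rewrite gt_eqF.
by rewrite ler_wpM2l ?lerDl// addr_ge0// ltW.
Unshelve. all: by end_near.
Qed.

End two_sample_distance.

(** * Sample sizes *)

Section sample_size_scaling.
Context {R : realType}.

Lemma sqrt_nat_cvgy (N : nat -> nat) :
  (N r @[r --> \oo] --> \oo)%N -> Num.sqrt (N r)%:R @[r --> \oo] --> (+oo : set_system R).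
Proof.
move=> /cvgnyPge NY; apply/cvgryPge => A; near=> r.
have h : (Num.truncn (A ^+ 2)).+1%:R <= (N r)%:R :> R.
  by rewrite ler_nat; near: r; exact: NY.
have [A0|A0] := leP A 0; first by apply: le_trans A0 _; exact: sqrtr_ge0.
rewrite -(ler_pXn2r (n := 2%N))// ?nnegrE ?sqrtr_ge0 ?ltW// sqr_sqrtr//.
by apply: lt_le_trans h; exact: Num.Theory.truncnS_gt.
Unshelve. all: by end_near.
Qed.

Lemma sqrt_ratio_cvg (N M : nat -> nat) (k : R) :
  (N r)%:R / (M r)%:R @[r --> \oo] --> k ->
  Num.sqrt (N r)%:R / Num.sqrt (M r)%:R @[r --> \oo] --> Num.sqrt k.
Proof.
move=> NM; under eq_fun do rewrite -sqrtrV// -sqrtrM//.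
by apply: continuous_cvg => //; exact: sqrt_continuous.
Qed.

Lemma complementary_ratio_cvg (N1 N2 : nat -> nat) (kappa : R) :
  1 < kappa -> (N1 r @[r --> \oo] --> \oo)%N ->
  (N1 r + N2 r)%:R / (N1 r)%:R @[r --> \oo] --> kappa ->
  (N1 r + N2 r)%:R / (N2 r)%:R @[r --> \oo] --> kappa / (kappa - 1).
Proof.
move=> k1 /cvgnyPge N1y Nk.
have k0 : kappa - 1 != 0 by rewrite subr_eq0 gt_eqF.
have h : ((N1 r + N2 r)%:R / (N1 r)%:R) / ((N1 r + N2 r)%:R / (N1 r)%:R - 1) @[r --> \oo]
    --> kappa / (kappa - 1).
  by apply: cvgM => //; apply: cvgV => //; apply: cvgB => //; exact: cvg_cst.
apply: cvg_trans h; apply: near_eq_cvg; near=> r.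
have N1r : (N1 r)%:R != 0 :> R.
  by rewrite pnatr_eq0 -lt0n; near: r; exact: N1y.
have -> : (N1 r + N2 r)%:R / (N1 r)%:R - 1 = (N2 r)%:R / (N1 r)%:R :> R.
  by rewrite natrD; field.
by rewrite invf_div mulrA divfK.
Unshelve. all: by end_near.
Qed.

End sample_size_scaling.

Unset Implicit Arguments.

(** * The limit law of the estimated distance *)

Theorem theorem2p1 (R : realType) (d p1 p2 k1 k2 : nat)
  (dO : measure_display) (Omega : measurableType dO) (P : probability Omega R)
  (X : set 'cV[R]_d)
  (x1 : 'I_k1 -> 'cV[R]_d) (x2 : 'I_k2 -> 'cV[R]_d)
  (m1 : 'cV[R]_d -> 'cV[R]_p1 -> R) (m2 : 'cV[R]_d -> 'cV[R]_p2 -> R)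
  (beta1 : 'cV[R]_p1) (beta2 : 'cV[R]_p2)
  (B1 : set 'cV[R]_p1) (B2 : set 'cV[R]_p2)
  (eta1 : 'I_k1 -> nat -> Omega -> R) (eta2 : 'I_k2 -> nat -> Omega -> R)
  (sigma1 sigma2 : R)
  (n1 : nat -> 'I_k1 -> nat) (n2 : nat -> 'I_k2 -> nat)
  (zeta1 : 'I_k1 -> R) (zeta2 : 'I_k2 -> R) (kappa : R)
  (betahat1 : nat -> Omega -> 'cV[R]_p1) (betahat2 : nat -> Omega -> 'cV[R]_p2)
  (phi1 : 'I_k1 -> nat -> Omega -> 'cV[R]_p1)
  (phi2 : 'I_k2 -> nat -> Omega -> 'cV[R]_p2)
  (s1 s2 : nat -> Omega -> R)
  (dO' : measure_display) (Omega' : measurableType dO')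
  (Q : probability Omega' R)
  (Z1 : Omega' -> 'cV[R]_p1) (Z2 : Omega' -> 'cV[R]_p2) :
  let n r := (sample_size n1 r + sample_size n2 r)%N in
  let Sigma1 := information_mx x1 m1 beta1 sigma1 zeta1 in
  let Sigma2 := information_mx x2 m2 beta2 sigma2 zeta2 in
  regression_model X x1 m1 beta1 -> regression_model X x2 m2 beta2 ->
  mutually_independent P (pooled eta1 eta2) ->
  errors_assumption P eta1 sigma1 -> errors_assumption P eta2 sigma2 ->
  compact X ->
  compact B1 -> compact B2 ->
  estimator x1 m1 beta1 eta1 n1 betahat1 ->
  estimator x2 m2 beta2 eta2 n2 betahat2 ->
  (forall r w, B1 (betahat1 r w)) -> (forall r w, B2 (betahat2 r w)) ->
  smoothness_assumption X m1 beta1 B1 -> smoothness_assumption X m2 beta2 B2 ->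
  identifiability_assumption x1 m1 B1 n1 ->
  identifiability_assumption x2 m2 B2 n2 ->
  design_assumption x1 m1 beta1 sigma1 n1 zeta1 ->
  design_assumption x2 m2 beta2 sigma2 n2 zeta2 ->
  1 < kappa ->
  (n r)%:R / (sample_size n1 r)%:R @[r --> \oo] --> kappa ->
  linearization_assumption P x1 m1 beta1 sigma1 n1 zeta1 betahat1 phi1 ->
  linearization_assumption P x2 m2 beta2 sigma2 n2 zeta2 betahat2 phi2 ->
  consistent_variance_estimator P x1 m1 beta1 eta1 sigma1 n1 s1 ->
  consistent_variance_estimator P x2 m2 beta2 eta2 sigma2 n2 s2 ->
  standard_normal_vector Q Z1 -> standard_normal_vector Q Z2 ->
  independent2 Q Z1 Z2 ->
  cvg_in_distribution P
    (fun r w => Num.sqrt (n r)%:R *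
       (L1_distance X m1 m2 (betahat1 r w) (betahat2 r w) -
        L1_distance X m1 m2 beta1 beta2))
    Q
    (fun w => limit_functional X m1 m2 beta1 beta2
       (limit_process m1 m2 Sigma1 Sigma2 kappa beta1 beta2 (Z1 w) (Z2 w))).
Proof.
move=> n Sigma1 Sigma2 _ _ indep err1 err2 cX _ _ est1 est2 inB1 inB2.
move=> [C2B1 [U1 [oU1 Ub1 C2U1]]] [C2B2 [U2 [oU2 Ub2 C2U2]]] _ _.
move=> [_ N1y _ _] [_ N2y _ _] kappa1 nk [_ _ _ _ asn1] [_ _ _ _ asn2] _ _ nZ1 nZ2 indZ.
have [mZ1 _] := nZ1; have [mZ2 _] := nZ2.
have estP := estimators_independent indep (errors_measurable err1)
  (errors_measurable err2) est1 est2.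
pose a r : R := Num.sqrt (n r)%:R.
pose a1 r : R := Num.sqrt (sample_size n1 r)%:R.
pose a2 r : R := Num.sqrt (sample_size n2 r)%:R.
pose h1 r (b : 'cV[R]_p1) := a1 r *: (b - beta1).
pose h2 r (b : 'cV[R]_p2) := a2 r *: (b - beta2).
pose U r w := col_mx (scaled_error beta1 n1 betahat1 r w) (scaled_error beta2 n2 betahat2 r w).
pose V w := col_mx (sqrtmx (invmx Sigma1) *m Z1 w) (sqrtmx (invmx Sigma2) *m Z2 w).
have mscale q (c : R) (b0 : 'cV[R]_q) : measurable_fun setT (fun b : 'cV[R]_q => c *: (b - b0)).
  apply: measurable_fun_mx => i j; under eq_fun do rewrite !mxE.
  apply: measurable_funM => //; apply: measurable_funB => //.
  exact: measurable_entry.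
have mh1 r : measurable_fun setT (h1 r) := mscale _ _ _.
have mh2 r : measurable_fun setT (h2 r) := mscale _ _ _.
have UV : cvg_bounded_lipschitz P Q U V.
  apply: independent_joint_cvg.
  - by move=> r; apply: (measurableT_comp (mh1 r)); have [] := estP r.
  - by move=> r; apply: (measurableT_comp (mh2 r)); have [] := estP r.
  - exact: measurable_mulmx.
  - exact: measurable_mulmx.
  - by move=> r; apply: (independent2_comp (mh1 r) (mh2 r)); have [] := estP r.
  - have mS q (S : 'M[R]_q) : measurable_fun setT (fun z : 'cV[R]_q => S *m z).
      by apply: measurable_mulmx; exact: measurable_id.
    exact: independent2_comp (mS _ _) (mS _ _) indZ.
  - exact: cvg_bounded_lipschitz_normal asn1 nZ1.
  - exact: cvg_bounded_lipschitz_normal asn2 nZ2.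
pose F u := limit_functional X m1 m2 beta1 beta2 (limit_path m1 m2 beta1 beta2
  (Num.sqrt kappa) (Num.sqrt (kappa / (kappa - 1))) u).
have FV w : limit_functional X m1 m2 beta1 beta2
    (limit_process m1 m2 Sigma1 Sigma2 kappa beta1 beta2 (Z1 w) (Z2 w)) = F (V w).
  rewrite /F; congr limit_functional; apply/funext => x.
  by rewrite /limit_process /limit_path col_mxKu col_mxKd -!scalemxAr !mxE.
under [X in cvg_in_distribution _ _ _ X]eq_fun do rewrite FV.
have F_cont : continuous F by exact: (limit_functional_continuous cX Ub1 Ub2 C2U1 C2U2).
have mV : measurable_fun setT V by apply: measurable_col_mx; exact: measurable_mulmx.
pose T r w := a r * (L1_distance X m1 m2 (betahat1 r w) (betahat2 r w) -
  L1_distance X m1 m2 beta1 beta2).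
(* the distance is continuous relative to B1 and B2, where the estimators take
   their values; betahat_l need not lie in U_l *)
have mT r : measurable_fun setT (T r).
  apply: measurable_funM => //; apply: measurable_funB => //.
  have [mb1 mb2 _] := estP r.
  rewrite (_ : (fun w => L1_distance X m1 m2 (betahat1 r w) (betahat2 r w)) =
    (fun w => (fun b => L1_distance X m1 m2 (usubmx b) (dsubmx b))
       (col_mx (betahat1 r w) (betahat2 r w)))); last first.
    by apply/funext => w; rewrite col_mxKu col_mxKd.
  apply: (within_continuous_comp_measurable (measurable_col_mx mb1 mb2) _
    (L1_distance_within_continuous cX C2B1 C2B2)) => w.
  by rewrite /= col_mxKu col_mxKd.
have ny : (n r @[r --> \oo] --> \oo)%N.
  apply/cvgnyPge => A; move/cvgnyPge/(_ A): N1y; apply: filterS => r.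
  by move=> h; apply: leq_trans h _; exact: leq_addr.
(* L1_distance_delta at v = U_r(w): then beta_l + v_l / sqrt n_l = betahat_l
   as soon as n_l > 0 *)
have delta := L1_distance_delta cX oU1 oU2 Ub1 Ub2 C2U1 C2U2
  (sqrt_nat_cvgy ny) (sqrt_nat_cvgy N1y) (sqrt_nat_cvgy N2y)
  (sqrt_ratio_cvg nk) (sqrt_ratio_cvg (complementary_ratio_cvg kappa1 N1y nk)).
move=> f f_cont [M fM].
have mf := continuous_measurable_fun f_cont.
have mfT r : measurable_fun setT (f \o T r) by exact: measurableT_comp.
have mfF : measurable_fun setT (f \o F \o V).
  apply: measurableT_comp mV; apply: continuous_measurable_cV => u.
  by apply: continuous_comp; [exact: F_cont|exact: f_cont].
split => //.
rewrite (expectation_bounded _ mfF (fun w => fM _)).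
under eq_fun do rewrite (expectation_bounded _ (mfT _) (fun w => fM _)).
apply: cvg_EFin; first by near=> r.
apply: (asymptotic_mapping UV (T := fun r w => f (T r w)) (F := f \o F) (M := M)) => //.
  by move=> u; exact: fM.
move=> u e e0.
have /cvgrPdist_le/(_ _ e0) := f_cont (F u).
move=> /nbhs_normP[df /= df0 Hdf].
have df2 : 0 < df / 2 by rewrite divr_gt0.
have [dl dl0 [K HK]] := delta u _ df2.
have [K1 _ HK1] : \forall r \near \oo, 0 < a1 r /\ 0 < a2 r.
  near=> r; split; near: r.
    by move/cvgryPgt : (sqrt_nat_cvgy (R := R) N1y); exact.
  by move/cvgryPgt : (sqrt_nat_cvgy (R := R) N2y); exact.
exists dl => //; exists (maxn K K1) => r w; rewrite geq_max => /andP[Kr K1r] Uu.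
have [a10 a20] := HK1 r K1r.
have := HK r (U r w) Kr Uu; rewrite col_mxKu col_mxKd /scaled_error !scalerA.
rewrite !mulVf ?gt_eqF// !scale1r !(addrC _ (_ - _)) !subrK => near_F.
rewrite distrC; apply: Hdf => /=; rewrite distrC.
by apply: le_lt_trans near_F _; rewrite ltr_pdivrMr// ltr_pMr// ltr1n.
Unshelve. all: by end_near.
Qed.
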